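(* Let $l\in\mathbb C$ with $0<|l|<1$ or $l=e^{i\theta}$, $0<\theta\le\pi$, and let $\mathcal D_l$ be the complex Lie algebra with basis $e_1,e_2,e_3$ and only non-zero brackets $[e_3,e_1]=e_1$, $[e_3,e_2]=le_2$. For a representation of $\mathcal D_l$ in one of the cases (AI)–(AVII), (BI)–(BVI), (CI) listed in the context, there exist bijective 1-cocycles if and only if it is equivalent to one of the representations listed below under the corresponding case. For each, the bijective 1-cocycles, classified up to equivalence, and the corresponding left-symmetric algebras (non-zero products) are as follows. Case (AI): $a=1$, $b=l$, $c=\lambda\in\mathbb C$: $q=(v_1,v_2,v_3)$; $({\rm D}_l\text{-}1)_\lambda$: $e_3e_1=e_1$, $e_3e_2=le_2$, $e_3e_3=\lambda e_3$. Case (AII): (AII-1) $a=l$, $c=1$: $q=(v_3,v_1,v_2)$; $({\rm D}_l\text{-}2)$: $e_3e_1=e_1$, $e_3e_2=le_2$, $e_3e_3=le_3+e_2$. (AII-2) $a=1$, $c=l$: $q=(v_1,v_3,v_2)$; $({\rm D}_l\text{-}3)$: $e_3e_1=e_1$, $e_3e_2=le_2$, $e_3e_3=e_3+e_1$. Case (AIII): there does not exist any bijective 1-cocycle. Case (AIV): (AIV-1) $b=\lambda\ne0$, $c=1$: $q=(v_3,v_1,\lambda v_2)$; $({\rm D}_l\text{-}4)_\lambda$: $e_2e_3=\lambda e_2$, $e_3e_1=e_1$, $e_3e_2=(\lambda+l)e_2$, $e_3e_3=\lambda e_3$. When $\lambda=-l$ there is an additional equivalence class $q=(v_3,\ lv_1,\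 v_1-l^2v_2)$; $({\rm D}_l\text{-}5)$: $e_2e_3=-le_2$, $e_3e_1=e_1$, $e_3e_3=-le_3+e_2$. When $\lambda=l$ there is an additional equivalence class $q=(v_3,v_2,v_1)$; $({\rm D}_l\text{-}6)$: $e_2e_2=e_3$, $e_3e_1=e_1$, $e_3e_2=le_2$, $e_3e_3=2le_3$. (AIV-2) $b=1-l$, $c=l$: $q=(v_1,\ \frac1{1-l}v_1+v_3,\ v_2)$; $({\rm D}_l\text{-}7)$: $e_2e_3=e_1$, $e_3e_1=e_1$, $e_3e_2=le_2+e_1$, $e_3e_3=(1-l)e_3$. (AIV-3)$_{\frac12}$ (only for $l=\frac12$) $b=\frac12$, $c=\lambda\in\mathbb C$: $q=(v_1,v_2,v_3)$; $({\rm D}_{\frac12}\text{-S-}1)_\lambda$: $e_2e_2=e_1$, $e_3e_1=e_1$, $e_3e_2=\frac12e_2$, $e_3e_3=\lambda e_3$. (When $\lambda=\frac12$ one has to add the class of $({\rm D}_{\frac12}\text{-}7)$; when $\lambda=1$ one has to add those of $({\rm D}_{\frac12}\text{-}4)_{\frac12}$ and $({\rm D}_{\frac12}\text{-}6)$.) Case (AV): for $l\ne\frac12$ there does not exist any bijective 1-cocycle; for $l=\frac12$: $c=1$: $q=(v_1,v_2,v_3)$; $({\rm D}_{\frac12}\text{-S-}2)$: $e_2e_2=e_1$, $e_3e_1=e_1$, $e_3e_2=\frac12e_2$, $e_3e_3=e_3+e_1$. Case (AVI): (AVI-1) $c=1$: $q=(v_1,v_2,v_3)$; $({\rm D}_l\text{-}8)$: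 $e_2e_3=e_2$, $e_3e_1=e_1$, $e_3e_2=(1+l)e_2$, $e_3e_3=e_3+e_1$. For $l=-1$ there is an additional equivalence class $q=(v_1,v_2,v_2+v_3)$; $({\rm D}_{-1}\text{-T-}1)$: $e_2e_3=e_2$, $e_3e_1=e_1$, $e_3e_3=e_3+e_1+e_2$. (AVI-2)$_{\frac12}$ (only for $l=\frac12$) $c=\frac12$: $q=(v_2,\ v_1+2v_2,\ 4v_2+v_3)$; $({\rm D}_{\frac12}\text{-S-}3)$: $e_2e_3=e_1$, $e_3e_1=e_1$, $e_3e_2=\frac12e_2+e_1$, $e_3e_3=\frac12e_3+e_2$. Case (AVII): for $l=\frac12$ there does not exist any bijective 1-cocycle; for $l\ne\frac12$: $c=1-2l$: $q=(v_1,v_2,(1-2l)v_3)$; $({\rm D}_{l\ne\frac12}\text{-S-}1)$: $e_2e_2=e_1$, $e_2e_3=(1-2l)e_2$, $e_3e_1=e_1$, $e_3e_2=(1-l)e_2$, $e_3e_3=(1-2l)e_3$. For $l=\frac13$ there is an additional equivalence class $q=(v_1,\frac32v_1+v_3,v_2)$; $({\rm D}_{\frac13}\text{-T-}1)$: $e_2e_2=e_3$, $e_2e_3=e_1$, $e_3e_1=e_1$, $e_3e_2=\frac13e_2+e_1$, $e_3e_3=\frac23e_3$. Case (BI): (BI-1) $c=2-l$: $q=(v_2,v_1,(2-l)v_3)$; $({\rm D}_l\text{-}9)$: $e_1e_1=e_2$, $e_2e_3=(2-l)e_2$, $e_3e_1=e_1$, $e_3e_2=2e_2$, $e_3e_3=(2-l)e_3$.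 (BI-2) $c=1$: $q=(v_3,v_2,v_1)$; $({\rm D}_l\text{-}10)$: $e_1e_2=e_2e_1=e_3$, $e_3e_1=e_1$, $e_3e_2=le_2$, $e_3e_3=(l+1)e_3$. (BI-3) (only for $l\neq\frac12$) $c=l$: $q=(v_1,v_3,(2l-1)v_2)$; $({\rm D}_{l\neq\frac12}\text{-S-}2)$: $e_1e_3=(2l-1)e_1$, $e_2e_2=e_1$, $e_3e_1=2le_1$, $e_3e_2=le_2$, $e_3e_3=(2l-1)e_3$. Case (BII): (BII-1) $c=\lambda\ne0$: $q=(v_2,v_1,\lambda v_3)$; $({\rm D}_l\text{-}11)_\lambda$: $e_1e_3=\lambda e_1$, $e_2e_3=\lambda e_2$, $e_3e_1=(\lambda+1)e_1$, $e_3e_2=(\lambda+l)e_2$, $e_3e_3=\lambda e_3$. Additional equivalence classes: when $\lambda=-1$, $q=(v_2,v_1,v_2-v_3)$; $({\rm D}_l\text{-}12)$: $e_1e_3=-e_1$, $e_2e_3=-e_2$, $e_3e_2=(l-1)e_2$, $e_3e_3=-e_3+e_1$; when $\lambda=-l$, $q=(v_2,v_1,\frac1lv_1-lv_3)$; $({\rm D}_l\text{-}13)$: $e_1e_3=-le_1$, $e_2e_3=-le_2$, $e_3e_1=(1-l)e_1$, $e_3e_3=-le_3+e_2$; when $\lambda=l-1$, $q=(v_2,\ v_1+\frac1{1-l}v_2,\ (l-1)v_3)$; $({\rm D}_l\text{-}14)$: $e_1e_3=(l-1)e_1$, $e_2e_3=(l-1)e_2+e_1$, $e_3e_1=le_1$,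 $e_3e_2=(2l-1)e_2+e_1$, $e_3e_3=(l-1)e_3$; when $\lambda=1-l$, $q=(\frac1{l-1}v_1+v_2,\ v_1,\ (1-l)v_3)$; $({\rm D}_l\text{-}15)$: $e_1e_3=(1-l)e_1+e_2$, $e_2e_3=(1-l)e_2$, $e_3e_1=(2-l)e_1+e_2$, $e_3e_2=e_2$, $e_3e_3=(1-l)e_3$. (BII-2)$_{\frac12}$ (only for $l=\frac12$) $c=-\frac12$: besides $({\rm D}_{\frac12}\text{-}11)_{-\frac12}$, $({\rm D}_{\frac12}\text{-}13)$ and $({\rm D}_{\frac12}\text{-}14)$ there is an additional equivalence class $q=(v_2,\ v_1+2v_2,\ 2v_1-\frac12v_3)$; $({\rm D}_{\frac12}\text{-S-}4)$: $e_1e_3=-\frac12e_1$, $e_2e_3=-\frac12e_2+e_1$, $e_3e_1=\frac12e_1$, $e_3e_2=e_1$, $e_3e_3=-\frac12e_3+e_2$. Case (BIII)$_{\frac12}$ ($l=\frac12$): $c=\lambda\neq0$: $q=(v_1,v_2,\lambda v_3)$; $({\rm D}_{\frac12}\text{-S-}5)_\lambda$: $e_1e_3=\lambda e_1$, $e_2e_2=e_1$, $e_2e_3=\lambda e_2$, $e_3e_1=(\lambda+1)e_1$, $e_3e_2=(\lambda+\frac12)e_2$, $e_3e_3=\lambda e_3$. When $\lambda=-1$ there is an additional equivalence class $q=(v_1,v_2,v_1-v_3)$; $({\rm D}_{\frac12}\text{-S-}6)$: $e_1e_3=-e_1$, $e_2e_2=e_1$, $e_2e_3=-e_2$, $e_3e_2=-\frac12e_2$,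 $e_3e_3=-e_3+e_1$. When $\lambda=\frac12$ there is an additional equivalence class $q=(v_2,v_3,v_1)$; $({\rm D}_{\frac12}\text{-S-}7)$: $e_1e_2=e_2e_1=e_3$, $e_2e_2=e_1$, $e_3e_1=e_1$, $e_3e_2=\frac12e_2$, $e_3e_3=\frac32e_3$. Case (BIV) ($l\ne-1$): (BIV-1) $b=\lambda\neq0$, $c=l$: $q=(v_1,v_3,\lambda v_2)$; $({\rm D}_{l\neq-1}\text{-}16)_\lambda$: $e_1e_3=\lambda e_1$, $e_3e_1=(\lambda+1)e_1$, $e_3e_2=le_2$, $e_3e_3=\lambda e_3$. When $\lambda=-1$ there is an additional equivalence class $q=(v_1,v_3,v_1-v_2)$; $({\rm D}_{l\neq-1}\text{-}17)$: $e_1e_3=-e_1$, $e_3e_2=le_2$, $e_3e_3=-e_3+e_1$. When $\lambda=1$ there is an additional equivalence class $q=(v_2,v_3,v_1)$; $({\rm D}_{l\neq-1}\text{-}18)$: $e_1e_1=e_3$, $e_3e_1=e_1$, $e_3e_2=le_2$, $e_3e_3=2e_3$. (BIV-2) $b=l-1$, $c=1$: $q=(\frac1{l-1}v_1+v_3,\ v_1,\ v_2)$; $({\rm D}_{l\neq-1}\text{-}19)$: $e_1e_3=e_2$, $e_3e_1=e_1+e_2$, $e_3e_2=le_2$, $e_3e_3=(l-1)e_3$. Case (BV) ($l\neq-1$): there does not exist any bijective 1-cocycle. Case (BVI) ($l\neq-1$): $c=l$: $q=(v_2,\ l^2v_1,\ lv_3)$; $({\rm D}_{l\neq-1}\text{-}20)$: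 $e_1e_3=le_1$, $e_3e_1=(1+l)e_1$, $e_3e_2=le_2$, $e_3e_3=le_3+e_2$. Case (CI) ($l\neq-1$): $c=l-2$: $q=(v_2,v_1,(l-2)v_3)$; $({\rm D}_{l\neq-1}\text{-}21)$: $e_1e_1=e_2$, $e_1e_3=(l-2)e_1$, $e_3e_1=(l-1)e_1$, $e_3e_2=le_2$, $e_3e_3=(l-2)e_3$.
   Context: $V$ has basis $v_1,v_2,v_3$; $E_{ij}\in gl(V)$ is the operator $v_i\mapsto v_j$, $v_k\mapsto0$ for $k\ne i$; $\mathrm{diag}(a,b,c)$ is $v_1\mapsto av_1,v_2\mapsto bv_2,v_3\mapsto cv_3$; $I$ is the identity. A linear map $q:\mathcal D_l\to V$ is written $q=(q(e_1),q(e_2),q(e_3))$. A displayed algebra (given by its non-zero products of basis vectors) is the left-symmetric algebra corresponding to the preceding 1-cocycle, up to isomorphism. Cases of representations of $\mathcal D_l$ (complex parameters): in cases (A·), $f(e_1)=0$ and: (AI) $f(e_2)=0$, $f(e_3)=\mathrm{diag}(a,b,c)$; (AII) $f(e_2)=0$, $f(e_3)=\mathrm{diag}(a,a,c)+E_{21}$; (AIII) $f(e_2)=0$, $f(e_3)=aI+E_{21}+E_{32}$; (AIV) $f(e_2)=E_{21}$, $f(e_3)=\mathrm{diag}(b+l,b,c)$; (AV) $f(e_2)=E_{21}$, $f(e_3)=\mathrm{diag}(c,c-l,c)+E_{31}$; (AVI) $f(e_2)=E_{32}$, $f(e_3)=\mathrm{diag}(c,c+l,c)+E_{31}$; (AVII)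 $f(e_2)=E_{21}+E_{32}$, $f(e_3)=\mathrm{diag}(c+2l,c+l,c)$. Further: (BI) $f(e_1)=E_{21}$, $f(e_2)=E_{31}$, $f(e_3)=\mathrm{diag}(c+l,c+l-1,c)$; (BII) $f(e_1)=E_{32}$, $f(e_2)=E_{31}$, $f(e_3)=\mathrm{diag}(c+l,c+1,c)$; (BIII)$_{\frac12}$ (only for $l=\frac12$) $f(e_1)=E_{31}$, $f(e_2)=E_{21}+E_{32}$, $f(e_3)=\mathrm{diag}(c+1,c+\frac12,c)$; and, only for $l\neq-1$, with $f(e_2)=0$: (BIV) $f(e_1)=E_{21}$, $f(e_3)=\mathrm{diag}(b+1,b,c)$; (BV) $f(e_1)=E_{21}$, $f(e_3)=\mathrm{diag}(c,c-1,c)+E_{31}$; (BVI) $f(e_1)=E_{32}$, $f(e_3)=\mathrm{diag}(c,c+1,c)+E_{31}$; (CI) $f(e_1)=E_{21}+E_{32}$, $f(e_3)=\mathrm{diag}(c+2,c+1,c)$. A left-symmetric algebra is a vector space with a bilinear product satisfying $(xy)z-x(yz)=(yx)z-y(xz)$. For a representation $f:\mathcal G\to gl(V)$ of a Lie algebra, a 1-cocycle associated to $f$ is a linear map $q:\mathcal G\to V$ with $q([x,y])=f(x)q(y)-f(y)q(x)$; it is bijective if $q$ is a linear isomorphism. A bijective 1-cocycle $(f,q)$ has the corresponding left-symmetric algebra $x*y=q^{-1}(f(x)q(y))$ on $\mathcal G$, whose commutator is the bracket of $\mathcal G$. Representations $(f_1,V_1),(f_2,V_2)$ are equivalent if $f_2(x)=g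 f_1(T(x))g^{-1}$ for some automorphism $T$ of $\mathcal G$ and linear isomorphism $g:V_1\to V_2$. Bijective 1-cocycles $(f_1,q_1),(f_2,q_2)$ are equivalent if there are such $T,g$ with $f_2(x)=g f_1(T(x))g^{-1}$ and $q_2=g q_1T$. *)

(* Defs.v *)
From HB Require Import structures.
From mathcomp Require Import all_boot all_order all_algebra.
From mathcomp Require Import ring.

Set Implicit Arguments.
Unset Strict Implicit.
Unset Printing Implicit Defensive.

Import GRing.Theory.
Local Open Scope ring_scope.

Section LieTheory.
Variables (K : fieldType) (G : vectType K).

Definition bilinear_op (m : G -> G -> G) : Prop :=
  (forall y, linear (m^~ y)) /\ (forall x, linear (m x)).

Definition lie_bracket (br : G -> G -> G) : Prop :=
  [/\ bilinear_op br,
      forall x, br x x = 0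
    & forall x y z, br x (br y z) + br y (br z x) + br z (br x y) = 0].

Definition left_symmetric (m : G -> G -> G) : Prop :=
  bilinear_op m /\
  forall x y z, m (m x y) z - m x (m y z) = m (m y x) z - m y (m x z).

Definition alg_isomorphic (m1 m2 : G -> G -> G) : Prop :=
  exists phi : 'End(G),
    bijective phi /\ forall x y, phi (m1 x y) = m2 (phi x) (phi y).

Variable br : G -> G -> G.

Definition lie_automorphism (T : 'End(G)) : Prop :=
  bijective T /\ forall x y, T (br x y) = br (T x) (T y).

Definition representation (V : vectType K) (f : 'Hom(G, 'End(V))) : Prop :=
  forall x y, f (br x y) = (f x \o f y)%VF - (f y \o f x)%VF.

Definition bijective_cocycle (V : vectType K)
    (f : 'Hom(G, 'End(V))) (q : 'Hom(G, V)) : Prop :=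
  [/\ representation f,
      forall x y, q (br x y) = f x (q y) - f y (q x)
    & bijective q].

Definition cocycle_product (V : vectType K)
    (f : 'Hom(G, 'End(V))) (q : 'Hom(G, V)) (x y : G) : G :=
  (q^-1)%VF (f x (q y)).

Definition rep_equivalent (V1 V2 : vectType K)
    (f1 : 'Hom(G, 'End(V1))) (f2 : 'Hom(G, 'End(V2))) : Prop :=
  exists (T : 'End(G)) (g : 'Hom(V1, V2)),
    [/\ lie_automorphism T, bijective g
      & forall x, f2 x = (g \o f1 (T x) \o g^-1)%VF].

Definition cocycle_equivalent (V1 V2 : vectType K)
    (f1 : 'Hom(G, 'End(V1))) (q1 : 'Hom(G, V1))
    (f2 : 'Hom(G, 'End(V2))) (q2 : 'Hom(G, V2)) : Prop :=
  exists (T : 'End(G)) (g : 'Hom(V1, V2)),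
    [/\ lie_automorphism T, bijective g,
        forall x, f2 x = (g \o f1 (T x) \o g^-1)%VF
      & q2 = (g \o q1 \o T)%VF].

End LieTheory.

Definition i1 : 'I_3 := @Ordinal 3 0 isT.
Definition i2 : 'I_3 := @Ordinal 3 1 isT.
Definition i3 : 'I_3 := @Ordinal 3 2 isT.

Section LinearMaps.
Variables (K : fieldType) (W : vectType K).

Definition comb3 (w1 w2 w3 : W) (x : 'rV[K]_3) : W :=
  x 0 i1 *: w1 + x 0 i2 *: w2 + x 0 i3 *: w3.

Fact comb3_is_linear w1 w2 w3 : linear (comb3 w1 w2 w3).
Proof.
move=> a x y; rewrite /comb3 !mxE !scalerDr !scalerDl !scalerA.
by rewrite (addrACA (_ *: w1)); apply: addrACA.
Qed.

HB.instance Definition _ w1 w2 w3 :=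
  GRing.isLinear.Build K 'rV[K]_3 W _ (comb3 w1 w2 w3)
    (comb3_is_linear w1 w2 w3).

(* The linear map sending the standard basis to w1, w2, w3. *)
Definition linmap (w1 w2 w3 : W) : 'Hom('rV[K]_3, W) :=
  linfun (comb3 w1 w2 w3).

End LinearMaps.

Section Dl.
Variable K : fieldType.

(* D_l and V are both modelled on K^3, with standard bases e1, e2, e3 and
   v1, v2, v3 respectively. *)
Definition bvec (i : 'I_3) : 'rV[K]_3 := delta_mx 0 i.
Notation e1 := (bvec i1).
Notation e2 := (bvec i2).
Notation e3 := (bvec i3).
Notation v1 := (bvec i1).
Notation v2 := (bvec i2).
Notation v3 := (bvec i3).

(* The bilinear product on K^3 whose products of basis vectors are
   e_i e_j = w for each entry (i, j, w) of t, and 0 for the other pairs. *)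
Definition table_product (t : seq ('I_3 * 'I_3 * 'rV[K]_3)) (x y : 'rV[K]_3) :
    'rV[K]_3 :=
  \sum_(p <- t) (x 0 p.1.1 * y 0 p.1.2) *: p.2.

Definition Dl_bracket (l : K) : 'rV[K]_3 -> 'rV[K]_3 -> 'rV[K]_3 :=
  table_product [:: (i3, i1, e1); (i1, i3, - e1);
                    (i3, i2, l *: e2); (i2, i3, - (l *: e2))].

Definition Eop (i j : 'I_3) : 'End('rV[K]_3) :=
  let w k := if k == i then bvec j else 0 in linmap (w i1) (w i2) (w i3).

Notation E21 := (Eop i2 i1).
Notation E31 := (Eop i3 i1).
Notation E32 := (Eop i3 i2).

Definition diag (a b c : K) : 'End('rV[K]_3) :=
  linmap (a *: v1) (b *: v2) (c *: v3).

Definition rep := 'Hom('rV[K]_3, 'End('rV[K]_3)).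
Definition cochain := 'Hom('rV[K]_3, 'rV[K]_3).
Definition product := 'rV[K]_3 -> 'rV[K]_3 -> 'rV[K]_3.

Definition repAI (a b c : K) : rep := linmap 0 0 (diag a b c).
Definition repAII (a c : K) : rep := linmap 0 0 (diag a a c + E21).
Definition repAIII (a : K) : rep := linmap 0 0 (diag a a a + E21 + E32).
Definition repAIV (l b c : K) : rep := linmap 0 E21 (diag (b + l) b c).
Definition repAV (l c : K) : rep := linmap 0 E21 (diag c (c - l) c + E31).
Definition repAVI (l c : K) : rep := linmap 0 E32 (diag c (c + l) c + E31).
Definition repAVII (l c : K) : rep :=
  linmap 0 (E21 + E32) (diag (c + l *+ 2) (c + l) c).
Definition repBI (l c : K) : rep :=
  linmap E21 E31 (diag (c + l) (c + l - 1) c).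
Definition repBII (l c : K) : rep := linmap E32 E31 (diag (c + l) (c + 1) c).
Definition repBIII (c : K) : rep :=
  linmap E31 (E21 + E32) (diag (c + 1) (c + 2^-1) c).
Definition repBIV (b c : K) : rep := linmap E21 0 (diag (b + 1) b c).
Definition repBV (c : K) : rep := linmap E21 0 (diag c (c - 1) c + E31).
Definition repBVI (c : K) : rep := linmap E32 0 (diag c (c + 1) c + E31).
Definition repCI (c : K) : rep :=
  linmap (E21 + E32) 0 (diag (c + 2) (c + 1) c).

Inductive rep_case : Set :=
  AI | AII | AIII | AIV | AV | AVI | AVII
| BI | BII | BIII | BIV | BV | BVI | CI.

Definition in_case (l : K) (cs : rep_case) (f : rep) : Prop :=
  match cs with
  | AI => exists a b c, f = repAI a b c
  | AII => exists a c, f = repAII a c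
  | AIII => exists a, f = repAIII a
  | AIV => exists b c, f = repAIV l b c
  | AV => exists c, f = repAV l c
  | AVI => exists c, f = repAVI l c
  | AVII => exists c, f = repAVII l c
  | BI => exists c, f = repBI l c
  | BII => exists c, f = repBII l c
  | BIII => l = 2^-1 /\ exists c, f = repBIII c
  | BIV => l <> -1 /\ exists b c, f = repBIV b c
  | BV => l <> -1 /\ exists c, f = repBV c
  | BVI => l <> -1 /\ exists c, f = repBVI c
  | CI => l <> -1 /\ exists c, f = repCI c
  end.

(* listed l cs f q m: under case cs, the classification displays the bijective
   1-cocycle q of the representation f, followed by the left-symmetric algebra
   with product m.  A representation displayed under two headings of a case
   (repAIV and repBII for l = 1/2) collects the cocycles of both, so the
   cross-references between such headings need no separate entry. *)
Inductive listed (l : K) : rep_case -> rep -> cochain -> product -> Prop :=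
| Dl_1 lam : listed l AI (repAI 1 l lam) (linmap v1 v2 v3)
    (table_product [:: (i3, i1, e1); (i3, i2, l *: e2); (i3, i3, lam *: e3)])
| Dl_2 : listed l AII (repAII l 1) (linmap v3 v1 v2)
    (table_product [:: (i3, i1, e1); (i3, i2, l *: e2);
                       (i3, i3, l *: e3 + e2)])
| Dl_3 : listed l AII (repAII 1 l) (linmap v1 v3 v2)
    (table_product [:: (i3, i1, e1); (i3, i2, l *: e2); (i3, i3, e3 + e1)])
| Dl_4 lam : lam <> 0 ->
    listed l AIV (repAIV l lam 1) (linmap v3 v1 (lam *: v2))
    (table_product [:: (i2, i3, lam *: e2); (i3, i1, e1);
                       (i3, i2, (lam + l) *: e2); (i3, i3, lam *: e3)])
| Dl_5 :
    listed l AIV (repAIV l (- l) 1) (linmap v3 (l *: v1) (v1 - l ^+ 2 *: v2))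
    (table_product [:: (i2, i3, - l *: e2); (i3, i1, e1);
                       (i3, i3, - l *: e3 + e2)])
| Dl_6 : listed l AIV (repAIV l l 1) (linmap v3 v2 v1)
    (table_product [:: (i2, i2, e3); (i3, i1, e1); (i3, i2, l *: e2);
                       (i3, i3, (l *+ 2) *: e3)])
| Dl_7 :
    listed l AIV (repAIV l (1 - l) l)
    (linmap v1 ((1 - l)^-1 *: v1 + v3) v2)
    (table_product [:: (i2, i3, e1); (i3, i1, e1); (i3, i2, l *: e2 + e1);
                       (i3, i3, (1 - l) *: e3)])
| Dhalf_S1 lam : l = 2^-1 ->
    listed l AIV (repAIV l 2^-1 lam) (linmap v1 v2 v3)
    (table_product [:: (i2, i2, e1); (i3, i1, e1); (i3, i2, 2^-1 *: e2);
                       (i3, i3, lam *: e3)])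
| Dhalf_S2 : l = 2^-1 -> listed l AV (repAV l 1) (linmap v1 v2 v3)
    (table_product [:: (i2, i2, e1); (i3, i1, e1); (i3, i2, 2^-1 *: e2);
                       (i3, i3, e3 + e1)])
| Dl_8 : listed l AVI (repAVI l 1) (linmap v1 v2 v3)
    (table_product [:: (i2, i3, e2); (i3, i1, e1); (i3, i2, (1 + l) *: e2);
                       (i3, i3, e3 + e1)])
| Dm1_T1 : l = -1 -> listed l AVI (repAVI l 1) (linmap v1 v2 (v2 + v3))
    (table_product [:: (i2, i3, e2); (i3, i1, e1); (i3, i3, e3 + e1 + e2)])
| Dhalf_S3 : l = 2^-1 ->
    listed l AVI (repAVI l 2^-1)
    (linmap v2 (v1 + 2 *: v2) (4 *: v2 + v3))
    (table_product [:: (i2, i3, e1); (i3, i1, e1); (i3, i2, 2^-1 *: e2 + e1);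
                       (i3, i3, 2^-1 *: e3 + e2)])
| Dnhalf_S1 : l <> 2^-1 ->
    listed l AVII (repAVII l (1 - l *+ 2))
    (linmap v1 v2 ((1 - l *+ 2) *: v3))
    (table_product [:: (i2, i2, e1); (i2, i3, (1 - l *+ 2) *: e2);
                       (i3, i1, e1); (i3, i2, (1 - l) *: e2);
                       (i3, i3, (1 - l *+ 2) *: e3)])
| Dthird_T1 : l = 3^-1 ->
    listed l AVII (repAVII l (1 - l *+ 2))
    (linmap v1 ((3 / 2) *: v1 + v3) v2)
    (table_product [:: (i2, i2, e3); (i2, i3, e1); (i3, i1, e1);
                       (i3, i2, 3^-1 *: e2 + e1); (i3, i3, (2 / 3) *: e3)])
| Dl_9 : listed l BI (repBI l (2 - l)) (linmap v2 v1 ((2 - l) *: v3))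
    (table_product [:: (i1, i1, e2); (i2, i3, (2 - l) *: e2); (i3, i1, e1);
                       (i3, i2, 2 *: e2); (i3, i3, (2 - l) *: e3)])
| Dl_10 : listed l BI (repBI l 1) (linmap v3 v2 v1)
    (table_product [:: (i1, i2, e3); (i2, i1, e3); (i3, i1, e1);
                       (i3, i2, l *: e2); (i3, i3, (l + 1) *: e3)])
| Dnhalf_S2 : l <> 2^-1 ->
    listed l BI (repBI l l) (linmap v1 v3 ((l *+ 2 - 1) *: v2))
    (table_product [:: (i1, i3, (l *+ 2 - 1) *: e1); (i2, i2, e1);
                       (i3, i1, (l *+ 2) *: e1); (i3, i2, l *: e2);
                       (i3, i3, (l *+ 2 - 1) *: e3)])
| Dl_11 lam : lam <> 0 ->
    listed l BII (repBII l lam) (linmap v2 v1 (lam *: v3))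
    (table_product [:: (i1, i3, lam *: e1); (i2, i3, lam *: e2);
                       (i3, i1, (lam + 1) *: e1); (i3, i2, (lam + l) *: e2);
                       (i3, i3, lam *: e3)])
| Dl_12 : listed l BII (repBII l (-1)) (linmap v2 v1 (v2 - v3))
    (table_product [:: (i1, i3, - e1); (i2, i3, - e2);
                       (i3, i2, (l - 1) *: e2); (i3, i3, - e3 + e1)])
| Dl_13 : listed l BII (repBII l (- l)) (linmap v2 v1 (l^-1 *: v1 - l *: v3))
    (table_product [:: (i1, i3, - l *: e1); (i2, i3, - l *: e2);
                       (i3, i1, (1 - l) *: e1); (i3, i3, - l *: e3 + e2)])
| Dl_14 :
    listed l BII (repBII l (l - 1))
    (linmap v2 (v1 + (1 - l)^-1 *: v2) ((l - 1) *: v3))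
    (table_product [:: (i1, i3, (l - 1) *: e1); (i2, i3, (l - 1) *: e2 + e1);
                       (i3, i1, l *: e1); (i3, i2, (l *+ 2 - 1) *: e2 + e1);
                       (i3, i3, (l - 1) *: e3)])
| Dl_15 :
    listed l BII (repBII l (1 - l))
    (linmap ((l - 1)^-1 *: v1 + v2) v1 ((1 - l) *: v3))
    (table_product [:: (i1, i3, (1 - l) *: e1 + e2); (i2, i3, (1 - l) *: e2);
                       (i3, i1, (2 - l) *: e1 + e2); (i3, i2, e2);
                       (i3, i3, (1 - l) *: e3)])
| Dhalf_S4 : l = 2^-1 ->
    listed l BII (repBII l (- 2^-1))
    (linmap v2 (v1 + 2 *: v2) (2 *: v1 - 2^-1 *: v3))
    (table_product [:: (i1, i3, - 2^-1 *: e1); (i2, i3, - 2^-1 *: e2 + e1);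
                       (i3, i1, 2^-1 *: e1); (i3, i2, e1);
                       (i3, i3, - 2^-1 *: e3 + e2)])
| Dhalf_S5 lam : l = 2^-1 -> lam <> 0 ->
    listed l BIII (repBIII lam) (linmap v1 v2 (lam *: v3))
    (table_product [:: (i1, i3, lam *: e1); (i2, i2, e1);
                       (i2, i3, lam *: e2); (i3, i1, (lam + 1) *: e1);
                       (i3, i2, (lam + 2^-1) *: e2); (i3, i3, lam *: e3)])
| Dhalf_S6 : l = 2^-1 -> listed l BIII (repBIII (-1)) (linmap v1 v2 (v1 - v3))
    (table_product [:: (i1, i3, - e1); (i2, i2, e1); (i2, i3, - e2);
                       (i3, i2, - 2^-1 *: e2); (i3, i3, - e3 + e1)])
| Dhalf_S7 : l = 2^-1 -> listed l BIII (repBIII 2^-1) (linmap v2 v3 v1)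
    (table_product [:: (i1, i2, e3); (i2, i1, e3); (i2, i2, e1);
                       (i3, i1, e1); (i3, i2, 2^-1 *: e2);
                       (i3, i3, (3 / 2) *: e3)])
| Dl_16 lam : l <> -1 -> lam <> 0 ->
    listed l BIV (repBIV lam l) (linmap v1 v3 (lam *: v2))
    (table_product [:: (i1, i3, lam *: e1); (i3, i1, (lam + 1) *: e1);
                       (i3, i2, l *: e2); (i3, i3, lam *: e3)])
| Dl_17 : l <> -1 -> listed l BIV (repBIV (-1) l) (linmap v1 v3 (v1 - v2))
    (table_product [:: (i1, i3, - e1); (i3, i2, l *: e2);
                       (i3, i3, - e3 + e1)])
| Dl_18 : l <> -1 -> listed l BIV (repBIV 1 l) (linmap v2 v3 v1)
    (table_product [:: (i1, i1, e3); (i3, i1, e1); (i3, i2, l *: e2);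
                       (i3, i3, 2 *: e3)])
| Dl_19 : l <> -1 ->
    listed l BIV (repBIV (l - 1) 1)
    (linmap ((l - 1)^-1 *: v1 + v3) v1 v2)
    (table_product [:: (i1, i3, e2); (i3, i1, e1 + e2); (i3, i2, l *: e2);
                       (i3, i3, (l - 1) *: e3)])
| Dl_20 : l <> -1 ->
    listed l BVI (repBVI l) (linmap v2 (l ^+ 2 *: v1) (l *: v3))
    (table_product [:: (i1, i3, l *: e1); (i3, i1, (1 + l) *: e1);
                       (i3, i2, l *: e2); (i3, i3, l *: e3 + e2)])
| Dl_21 : l <> -1 ->
    listed l CI (repCI (l - 2)) (linmap v2 v1 ((l - 2) *: v3))
    (table_product [:: (i1, i1, e2); (i1, i3, (l - 2) *: e1);
                       (i3, i1, (l - 1) *: e1); (i3, i2, l *: e2);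
                       (i3, i3, (l - 2) *: e3)]).

Definition listed_rep (l : K) (cs : rep_case) (f : rep) : Prop :=
  exists q m, listed l cs f q m.

Definition listed_cocycle (l : K) (cs : rep_case) (f : rep) (q : cochain) :
    Prop :=
  exists m, listed l cs f q m.

Lemma table_product_bilinear t : bilinear_op (table_product t).
Proof.
split=> [y|x] a u v; rewrite /table_product scaler_sumr -big_split /=;
  apply: eq_bigr => p _; rewrite !mxE scalerA -scalerDl; congr (_ *: _).
  by rewrite mulrDl mulrA.
by rewrite mulrDr !mulrA [_ * a]mulrC.
Qed.

Lemma Dl_lie_bracket l : lie_bracket (Dl_bracket l).
Proof.
split=> [|x|x y z]; first exact: table_product_bilinear.
  apply/rowP=> j; rewrite /Dl_bracket /table_product !big_cons !big_nil !mxE /=.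
  by ring.
apply/rowP=> j; rewrite /Dl_bracket /table_product !big_cons !big_nil !mxE /=.
by case: j => [[|[|[|//]]] ij] /=; ring.
Qed.

End Dl.

(* Main.v *)
Require Import Defs.
From mathcomp Require Import all_boot all_order all_algebra ring.
From mathcomp Require Import complex.
From mathcomp Require Import all_classical all_reals all_analysis.

Set Implicit Arguments.
Unset Strict Implicit.
Unset Printing Implicit Defensive.

Import Order.TTheory GRing.Theory Num.Theory.
Local Open Scope ring_scope.

(** A bijective 1-cocycle [(f, q)] carries the same information as its product
    [x * y = q^-1 (f x (q y))], and two of them are equivalent exactly when some
    automorphism of the Lie algebra intertwines their products
    ([cocycle_equivalent_of_iso], [iso_of_cocycle_equivalent]).  Such an
    automorphism is very constrained when [l] is neither 0 nor 1
    ([lie_automorphism_cases]): it maps [e1, e2, e3] to [alpha e1], [beta e2],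
    [e3 + u e1 + w e2], or, for [l = -1] only, it exchanges the lines of [e1]
    and [e2] and maps [e3] to [- e3 + u e1 + w e2].

    All the operators of the classification are triangular, so that being a
    bijective cocycle means that the nine coordinates of [q e1, q e2, q e3] have
    a nonzero determinant and satisfy linear equations whose coefficients are
    affine in the parameters ([bijective_cocycle_eqs]).  The vectors [q e1] and
    [q e2] solve, up to correction terms, the eigenvector equations of [f e3]
    for the eigenvalues 1 and [l].  Since they are nonzero, the parameters are
    forced to the displayed values; in cases AIII and BV they are forced to be
    linearly dependent, so that no cocycle is bijective.  In the other cases
    explicit [alpha, beta, u, w] bring the cocycle to a displayed one (lemmas
    [normalise_AI] to [normalise_CI]).  The scalars [u] and [w] remove the
    unwanted components of the products with [e3], unless the coefficient of [u]
    or [w] in the corresponding linear equation vanishes: these exceptional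
    parameters carry the additional classes, whose remaining component is scaled
    to 1 by [alpha] or [beta].  Where a square such as [e2 * e2] has to be
    scaled, a square root is extracted, and a cube root for the algebra with
    [e1 * e2 = e3] and [e2 * e2 = e1].

    Different displayed cocycles of one representation are told apart by
    evaluating a hypothetical isomorphism of their products on a pair of basis
    vectors ([listed_iso_inj]).  The only properties of [l] needed are
    [l <> 0, 1, 2, 3], which follow from [`|l| <= 1] and [l <> 0, 1]. *)

(** * Cocycles, products and equivalence *)

Section Transport.
Variables (K : fieldType) (G : vectType K) (br : G -> G -> G).

Lemma bij_lfunK (U W : vectType K) (f : 'Hom(U, W)) :
  bijective f -> cancel f (f^-1)%VF /\ cancel (f^-1)%VF f.
Proof.
move=> bf; have fK : cancel f (f^-1)%VF.
  by apply/lker0_lfunK/lker0P/bij_inj.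
by split=> //; case: bf => h _ hK y; rewrite -[y]hK fK.
Qed.

Lemma bij_lfunV (U W : vectType K) (f : 'Hom(U, W)) :
  bijective f -> bijective (f^-1)%VF.
Proof. by move=> /bij_lfunK [fK Kf]; exists f. Qed.

Lemma lie_automorphismV (T : 'End(G)) :
  lie_automorphism br T -> lie_automorphism br (T^-1)%VF.
Proof.
move=> [bT TM]; have [TK KT] := bij_lfunK bT.
split=> [|x y]; first exact: bij_lfunV.
by rewrite -{1}[x]KT -{1}[y]KT -TM TK.
Qed.

Lemma lie_automorphism_comp (S T : 'End(G)) :
  lie_automorphism br S -> lie_automorphism br T ->
  lie_automorphism br (S \o T)%VF.
Proof.
move=> [bS SM] [bT TM]; split=> [|x y]; last by rewrite !comp_lfunE TM SM.
by apply: (eq_bij (bij_comp bS bT)) => x; rewrite comp_lfunE.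
Qed.

Lemma lie_automorphism1 : lie_automorphism br \1%VF.
Proof.
split=> [|x y]; last by rewrite !id_lfunE.
by exists (\1%VF : 'End(G)) => x; rewrite !id_lfunE.
Qed.

Section Cocycles.
Variable V : vectType K.
Implicit Types (f : 'Hom(G, 'End(V))) (q : 'Hom(G, V)) (m : G -> G -> G).

(** [phi] carries the product [m] to the product attached to the cocycle [q] of
    [f]; for a bijective [q] this says that [phi] is a morphism from [m] to
    [cocycle_product f q]. *)
Definition intertwines f q m (phi : 'End(G)) : Prop :=
  forall x y, q (phi (m x y)) = f (phi x) (q (phi y)).

(** [m] is the product of the bijective cocycle [q], up to a Lie algebra
    automorphism: some displayed tables agree with the product of the displayed
    cocycle only after a change of basis. *)
Definition realises f q m : Prop :=
  bijective q /\ exists2 phi, lie_automorphism br phi & intertwines f q m phi.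

Lemma realises_commutator f q m :
  bijective_cocycle br f q -> realises f q m ->
  forall x y, m x y - m y x = br x y.
Proof.
move=> [_ qc _] [bq [phi aphi qm]] x y.
apply/(bij_inj aphi.1)/(bij_inj bq).
by rewrite !linearB /= !qm aphi.2 qc.
Qed.

(** The identity [(x y - y x) z = x (y z) - y (x z)] transports the fact that
    [f] is a representation. *)
Lemma realises_left_symmetric f q m :
  bijective_cocycle br f q -> realises f q m -> bilinear_op m ->
  left_symmetric m.
Proof.
move=> qc qm mL; have mbr := realises_commutator qc qm.
case: qc => fM _ _; case: qm => bq [phi aphi qm].
split=> // x y z.
have ml u v t : m (u - v) t = m u t - m v t.
  by have := mL.1 t (-1) v u; rewrite !scaleN1r [- v + u]addrC => ->; rewrite addrC.
have : m (br x y) z = m x (m y z) - m y (m x z).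
  apply/(bij_inj aphi.1)/(bij_inj bq).
  rewrite !linearB /= !qm aphi.2 fM.
  by rewrite add_lfunE opp_lfunE !comp_lfunE.
rewrite -mbr ml => /eqP; rewrite subr_eq => /eqP ->.
by rewrite addrAC [X in X + _]addrAC subrr add0r addrC.
Qed.

Lemma realises_alg_isomorphic f q m :
  realises f q m -> alg_isomorphic (cocycle_product f q) m.
Proof.
move=> [bq [phi [bphi _] qm]]; have [qK _] := bij_lfunK bq.
have [phiK Kphi] := bij_lfunK bphi.
exists (phi^-1)%VF; split=> [|x y]; first exact: bij_lfunV.
by rewrite /cocycle_product -{1}[x]Kphi -{1}[y]Kphi -qm qK phiK.
Qed.

End Cocycles.

Lemma cocycle_equivalent_of_iso (V V0 : vectType K)
    (f : 'Hom(G, 'End(V))) (q : 'Hom(G, V))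
    (f0 : 'Hom(G, 'End(V0))) (q0 : 'Hom(G, V0)) m0 (T : 'End(G)) :
  bijective q -> realises f0 q0 m0 -> lie_automorphism br T ->
  intertwines f q m0 T -> cocycle_equivalent br f q f0 q0.
Proof.
move=> bq [bq0 [phi aphi qm0]] aT Tm; have [qK Kq] := bij_lfunK bq.
have [q0K Kq0] := bij_lfunK bq0; have [TK KT] := bij_lfunK aT.1.
have [phiK Kphi] := bij_lfunK aphi.1.
pose g := (q0 \o phi \o T^-1 \o q^-1)%VF.
have gE y : g (q (T y)) = q0 (phi y) by rewrite !comp_lfunE qK TK.
have bg : bijective g.
  apply: (@Bijective _ _ _ (fun v => q (T ((phi^-1)%VF ((q0^-1)%VF v))))) => v.
    by rewrite !comp_lfunE q0K phiK KT Kq.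
  by rewrite gE Kphi Kq0.
have [gK Kg] := bij_lfunK bg; clearbody g.
exists (T \o phi^-1)%VF, g; split=> // [|x|].
- exact/lie_automorphism_comp/lie_automorphismV.
- apply/lfunP => v; rewrite -[v]Kq0 -[(q0^-1)%VF v]Kphi -[x]Kphi.
  set y := (phi^-1)%VF _; set z := (phi^-1)%VF _.
  by rewrite !comp_lfunE phiK -gE gK -Tm !gE qm0.
by apply/lfunP => v; rewrite !comp_lfunE gE Kphi.
Qed.

Lemma iso_of_cocycle_equivalent (V1 V2 : vectType K)
    (f1 : 'Hom(G, 'End(V1))) (q1 : 'Hom(G, V1)) m1
    (f2 : 'Hom(G, 'End(V2))) (q2 : 'Hom(G, V2)) m2 :
  realises f1 q1 m1 -> realises f2 q2 m2 -> cocycle_equivalent br f1 q1 f2 q2 ->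
  exists2 T : 'End(G), lie_automorphism br T &
    forall x y, T (m2 x y) = m1 (T x) (T y).
Proof.
move=> [bq1 [p1 ap1 qm1]] [_ [p2 ap2 qm2]] [T [g [aT bg fE qE]]].
have [gK _] := bij_lfunK bg; have [_ Kp1] := bij_lfunK ap1.1.
exists (p1^-1 \o T \o p2)%VF => [|x y].
  by do 2?apply: lie_automorphism_comp=> //; apply: lie_automorphismV.
apply/(bij_inj ap1.1)/(bij_inj bq1)/(bij_inj bg).
have := qm2 x y; rewrite qm1 qE fE !comp_lfunE gK !Kp1 => ->.
by rewrite ?comp_lfunE ?Kp1.
Qed.

Lemma rep_equivalent_of_cocycle (V1 V2 : vectType K)
    (f1 : 'Hom(G, 'End(V1))) (q1 : 'Hom(G, V1))
    (f2 : 'Hom(G, 'End(V2))) (q2 : 'Hom(G, V2)) :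
  cocycle_equivalent br f1 q1 f2 q2 -> rep_equivalent br f1 f2.
Proof. by case=> T [g [aT bg fE _]]; exists T, g. Qed.

(** The transported cocycle is [g^-1 o q2 o T^-1]. *)
Lemma rep_equivalent_bijective_cocycle (V1 V2 : vectType K)
    (f1 : 'Hom(G, 'End(V1))) (f2 : 'Hom(G, 'End(V2))) (q2 : 'Hom(G, V2)) :
  rep_equivalent br f1 f2 -> bijective_cocycle br f2 q2 ->
  exists q1 : 'Hom(G, V1), bijective_cocycle br f1 q1.
Proof.
move=> [T [g [aT bg fE]]] [f2M q2c bq2].
have [gK Kg] := bij_lfunK bg; have [TK KT] := bij_lfunK aT.1.
have aV := lie_automorphismV aT.
have f1E x v : f1 x v = (g^-1)%VF (f2 ((T^-1)%VF x) (g v)).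
  by rewrite fE !comp_lfunE KT !gK.
exists (g^-1 \o q2 \o T^-1)%VF; split=> [x y|x y|].
- apply/lfunP => v; rewrite add_lfunE opp_lfunE !comp_lfunE !f1E !Kg aV.2 f2M.
  by rewrite add_lfunE opp_lfunE !comp_lfunE linearB.
- by rewrite !comp_lfunE aV.2 q2c !f1E !Kg linearB.
apply: (@Bijective _ _ _ (fun v => T ((q2^-1)%VF (g v)))) => v.
  by rewrite !comp_lfunE Kg; have [-> _] := bij_lfunK bq2; rewrite KT.
by rewrite !comp_lfunE TK; have [_ ->] := bij_lfunK bq2; rewrite gK.
Qed.

End Transport.

(** * Coordinates and triangular operators *)

Section Coordinates.
Variable K : fieldType.

(** The vector with coordinates [a, b, c]. *)
Definition row3 (a b c : K) : 'rV[K]_3 := \row_j nth 0 [:: a; b; c] j.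

Lemma row3_eta (x : 'rV[K]_3) : x = row3 (x 0 i1) (x 0 i2) (x 0 i3).
Proof.
apply/rowP=> -[[|[|[|//]]] lt3]; rewrite mxE /=; congr (x _ _); exact: val_inj.
Qed.

Lemma row3_inj a b c a' b' c' :
  row3 a b c = row3 a' b' c' -> [/\ a = a', b = b' & c = c'].
Proof.
move=> E; have Ej j : row3 a b c 0 j = row3 a' b' c' 0 j by rewrite E.
by have := (Ej i1, Ej i2, Ej i3); rewrite !mxE /= => -[[-> ->] ->].
Qed.

Lemma row3D a b c a' b' c' :
  row3 a b c + row3 a' b' c' = row3 (a + a') (b + b') (c + c').
Proof. by apply/rowP=> -[[|[|[|//]]] lt3]; rewrite !mxE. Qed.

Lemma row3N a b c : - row3 a b c = row3 (- a) (- b) (- c).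
Proof. by apply/rowP=> -[[|[|[|//]]] lt3]; rewrite !mxE. Qed.

Lemma row3Z k a b c : k *: row3 a b c = row3 (k * a) (k * b) (k * c).
Proof. by apply/rowP=> -[[|[|[|//]]] lt3]; rewrite !mxE. Qed.

Lemma row30 : 0 = row3 0 0 0.
Proof. by apply/rowP=> -[[|[|[|//]]] lt3]; rewrite !mxE. Qed.

Lemma bvec_row3 : (bvec K i1 = row3 1 0 0) * (bvec K i2 = row3 0 1 0) *
                  (bvec K i3 = row3 0 0 1).
Proof.
by split; first split; apply/rowP=> -[[|[|[|//]]] lt3]; rewrite !mxE.
Qed.

Definition row3E := (bvec_row3, row3Z, row3N, row3D).

Lemma row3_i1 a b c : row3 a b c 0 i1 = a. Proof. by rewrite mxE. Qed.
Lemma row3_i2 a b c : row3 a b c 0 i2 = b. Proof. by rewrite mxE. Qed.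
Lemma row3_i3 a b c : row3 a b c 0 i3 = c. Proof. by rewrite mxE. Qed.
Definition row3_coord := (row3_i1, row3_i2, row3_i3).

Lemma linmap_row3 (W : vectType K) (w1 w2 w3 : W) a b c :
  linmap w1 w2 w3 (row3 a b c) = a *: w1 + b *: w2 + c *: w3.
Proof. by rewrite /linmap lfunE /= /comb3 !row3_coord. Qed.

Lemma linmap_bvec (W : vectType K) (w1 w2 w3 : W) :
  (linmap w1 w2 w3 (bvec K i1) = w1) * (linmap w1 w2 w3 (bvec K i2) = w2) *
  (linmap w1 w2 w3 (bvec K i3) = w3).
Proof.
by rewrite !bvec_row3 !linmap_row3 !scale1r !scale0r !addr0 !add0r.
Qed.

Lemma linmap_eta (W : vectType K) (f : 'Hom('rV[K]_3, W)) :
  f = linmap (f (bvec K i1)) (f (bvec K i2)) (f (bvec K i3)).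
Proof.
apply/lfunP=> x; rewrite [x]row3_eta linmap_row3 -!linearZ -!linearD /=.
by rewrite !row3E; congr (f (row3 _ _ _));
   rewrite !(mulr0, mulr1, addr0, add0r).
Qed.

Lemma linmap_inj (W : vectType K) (w1 w2 w3 w1' w2' w3' : W) :
  linmap w1 w2 w3 = linmap w1' w2' w3' -> [/\ w1 = w1', w2 = w2' & w3 = w3'].
Proof.
move=> E; have := linmap_bvec w1 w2 w3; rewrite E !linmap_bvec.
by case=> -[-> ->] ->.
Qed.

(** The determinant of the matrix whose rows are the [(xi, yi, zi)]. *)
Definition det3 (x1 y1 z1 x2 y2 z2 x3 y3 z3 : K) :=
  x1 * (y2 * z3 - z2 * y3) - y1 * (x2 * z3 - z2 * x3)
  + z1 * (x2 * y3 - y2 * x3).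

Lemma linmap_bijective x1 y1 z1 x2 y2 z2 x3 y3 z3 :
  bijective (linmap (row3 x1 y1 z1) (row3 x2 y2 z2) (row3 x3 y3 z3)) <->
  det3 x1 y1 z1 x2 y2 z2 x3 y3 z3 != 0.
Proof.
set q := linmap _ _ _; set d := det3 _ _ _ _ _ _ _ _ _.
pose A : 'M[K]_3 := \matrix_(i, j) nth 0 (nth [::]
  [:: [:: x1; y1; z1]; [:: x2; y2; z2]; [:: x3; y3; z3]] i) j.
have qA x : q x = x *m A.
  rewrite [x]row3_eta linmap_row3 !row3E; apply/rowP=> j.
  rewrite !mxE !big_ord_recl big_ord0 !mxE /=.
  by case: j => -[|[|[|//]]] lt3; rewrite /= addr0 !addrA.
have detA : \det A = d.
  rewrite (expand_det_row _ ord0) !big_ord_recl big_ord0 /cofactor.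
  rewrite !(expand_det_row _ ord0) !big_ord_recl !big_ord0 /cofactor.
  rewrite !det_mx11 !mxE /= /d /det3 /bump /=; ring.
split=> [bq|dN0].
  rewrite -detA; apply/negP=> /det0P[v vN0 vA]; case/eqP: vN0.
  by apply: (bij_inj bq); rewrite linear0 qA.
have uA : A \in unitmx by rewrite unitmxE detA unitfE.
by exists (fun v => v *m invmx A) => v; rewrite qA ?mulmxK ?mulmxKV.
Qed.

(** The triangular operator with diagonal [d1, d2, d3] whose strict part is
    [a21 E_21 + a31 E_31 + a32 E_32]; it maps [v1, v2, v3] to [d1 v1],
    [a21 v1 + d2 v2], [a31 v1 + a32 v2 + d3 v3]. *)
Definition ut (d1 d2 d3 a21 a31 a32 : K) : 'End('rV[K]_3) :=
  linmap (row3 d1 0 0) (row3 a21 d2 0) (row3 a31 a32 d3).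

Lemma utE d1 d2 d3 a21 a31 a32 x y z :
  ut d1 d2 d3 a21 a31 a32 (row3 x y z) =
  row3 (d1 * x + a21 * y + a31 * z) (d2 * y + a32 * z) (d3 * z).
Proof. by rewrite linmap_row3 !row3E; congr row3; ring. Qed.

Lemma lfun_row3 (f g : 'End('rV[K]_3)) :
  (forall x y z, f (row3 x y z) = g (row3 x y z)) -> f = g.
Proof. by move=> fg; apply/lfunP=> v; rewrite [v]row3_eta. Qed.

Lemma utD d1 d2 d3 a21 a31 a32 d1' d2' d3' a21' a31' a32' :
  ut d1 d2 d3 a21 a31 a32 + ut d1' d2' d3' a21' a31' a32' =
  ut (d1 + d1') (d2 + d2') (d3 + d3') (a21 + a21') (a31 + a31') (a32 + a32').
Proof.
by apply: lfun_row3=> x y z; rewrite add_lfunE !utE row3D; congr row3; ring.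
Qed.

Lemma ut0 : 0 = ut 0 0 0 0 0 0.
Proof.
by apply: lfun_row3=> x y z; rewrite zero_lfunE utE row30; congr row3; ring.
Qed.

Lemma diag_ut a b c : diag a b c = ut a b c 0 0 0.
Proof.
by apply: lfun_row3=> x y z; rewrite linmap_row3 utE !row3E; congr row3; ring.
Qed.

Lemma Eop_ut : (Eop K i2 i1 = ut 0 0 0 1 0 0) * (Eop K i3 i1 = ut 0 0 0 0 1 0) *
               (Eop K i3 i2 = ut 0 0 0 0 0 1).
Proof.
split; first split; apply: lfun_row3=> x y z;
  rewrite linmap_row3 /= utE !row3E row30 !row3E; congr row3; ring.
Qed.

End Coordinates.

(** Proves an equality by exhibiting it as a consequence of a known one; with a
    ring identity as second premise it replaces a linear combination of
    hypotheses. *)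
Lemma eq_of_sub (V : zmodType) (a b c d : V) : a = b -> c - d = a - b -> c = d.
Proof. by move=> ->; rewrite subrr => /eqP; rewrite subr_eq0 => /eqP. Qed.

(** * The cocycle equations and the automorphisms of the algebra *)

Section Dl.
Variable K : fieldType.
Implicit Type l : K.

Lemma mulr_eq0r (a b : K) : a * b = 0 -> a != 0 -> b = 0.
Proof. by move/eqP; rewrite mulf_eq0 => /orP[/eqP-> | /eqP-> //]; rewrite eqxx. Qed.

Lemma repAI_ut (a b c : K) : repAI a b c =
  linmap (ut 0 0 0 0 0 0) (ut 0 0 0 0 0 0) (ut a b c 0 0 0).
Proof. by rewrite /repAI diag_ut ut0. Qed.

Lemma repAII_ut (a c : K) : repAII a c =
  linmap (ut 0 0 0 0 0 0) (ut 0 0 0 0 0 0) (ut a a c 1 0 0).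
Proof. by rewrite /repAII diag_ut Eop_ut utD !(addr0, add0r) ut0. Qed.

Lemma repAIII_ut (a : K) : repAIII a =
  linmap (ut 0 0 0 0 0 0) (ut 0 0 0 0 0 0) (ut a a a 1 0 1).
Proof. by rewrite /repAIII diag_ut !Eop_ut !utD !(addr0, add0r) ut0. Qed.

Lemma repAIV_ut l b c : repAIV l b c =
  linmap (ut 0 0 0 0 0 0) (ut 0 0 0 1 0 0) (ut (b + l) b c 0 0 0).
Proof. by rewrite /repAIV diag_ut Eop_ut ut0. Qed.

Lemma repAV_ut l c : repAV l c =
  linmap (ut 0 0 0 0 0 0) (ut 0 0 0 1 0 0) (ut c (c - l) c 0 1 0).
Proof. by rewrite /repAV diag_ut !Eop_ut utD !(addr0, add0r) ut0. Qed.

Lemma repAVI_ut l c : repAVI l c =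
  linmap (ut 0 0 0 0 0 0) (ut 0 0 0 0 0 1) (ut c (c + l) c 0 1 0).
Proof. by rewrite /repAVI diag_ut !Eop_ut utD !(addr0, add0r) ut0. Qed.

Lemma repAVII_ut l c : repAVII l c =
  linmap (ut 0 0 0 0 0 0) (ut 0 0 0 1 0 1) (ut (c + l *+ 2) (c + l) c 0 0 0).
Proof. by rewrite /repAVII diag_ut !Eop_ut utD !(addr0, add0r) ut0. Qed.

Lemma repBI_ut l c : repBI l c =
  linmap (ut 0 0 0 1 0 0) (ut 0 0 0 0 1 0) (ut (c + l) (c + l - 1) c 0 0 0).
Proof. by rewrite /repBI diag_ut !Eop_ut. Qed.

Lemma repBII_ut l c : repBII l c =
  linmap (ut 0 0 0 0 0 1) (ut 0 0 0 0 1 0) (ut (c + l) (c + 1) c 0 0 0).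
Proof. by rewrite /repBII diag_ut !Eop_ut. Qed.

Lemma repBIII_ut (c : K) : repBIII c =
  linmap (ut 0 0 0 0 1 0) (ut 0 0 0 1 0 1) (ut (c + 1) (c + 2^-1) c 0 0 0).
Proof. by rewrite /repBIII diag_ut !Eop_ut utD !(addr0, add0r). Qed.

Lemma repBIV_ut (b c : K) : repBIV b c =
  linmap (ut 0 0 0 1 0 0) (ut 0 0 0 0 0 0) (ut (b + 1) b c 0 0 0).
Proof. by rewrite /repBIV diag_ut Eop_ut ut0. Qed.

Lemma repBV_ut (c : K) : repBV c =
  linmap (ut 0 0 0 1 0 0) (ut 0 0 0 0 0 0) (ut c (c - 1) c 0 1 0).
Proof. by rewrite /repBV diag_ut !Eop_ut utD !(addr0, add0r) ut0. Qed.

Lemma repBVI_ut (c : K) : repBVI c =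
  linmap (ut 0 0 0 0 0 1) (ut 0 0 0 0 0 0) (ut c (c + 1) c 0 1 0).
Proof. by rewrite /repBVI diag_ut !Eop_ut utD !(addr0, add0r) ut0. Qed.

Lemma repCI_ut (c : K) : repCI c =
  linmap (ut 0 0 0 1 0 1) (ut 0 0 0 0 0 0) (ut (c + 2) (c + 1) c 0 0 0).
Proof. by rewrite /repCI diag_ut !Eop_ut utD !(addr0, add0r) ut0. Qed.

Definition rep_ut := (repAI_ut, repAII_ut, repAIII_ut, repAIV_ut, repAV_ut,
  repAVI_ut, repAVII_ut, repBI_ut, repBII_ut, repBIII_ut, repBIV_ut, repBV_ut,
  repBVI_ut, repCI_ut).

Lemma linmap_row3_row3 (x1 y1 z1 x2 y2 z2 x3 y3 z3 a b c : K) :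
  linmap (row3 x1 y1 z1) (row3 x2 y2 z2) (row3 x3 y3 z3) (row3 a b c) =
  row3 (a * x1 + b * x2 + c * x3) (a * y1 + b * y2 + c * y3)
       (a * z1 + b * z2 + c * z3).
Proof. by rewrite linmap_row3 !row3Z !row3D. Qed.

Lemma rep_row3 (a21 a31 a32 b21 b31 b32 d1 d2 d3 c21 c31 c32 a b c x y z : K) :
  linmap (ut 0 0 0 a21 a31 a32) (ut 0 0 0 b21 b31 b32)
         (ut d1 d2 d3 c21 c31 c32) (row3 a b c) (row3 x y z) =
  row3 (a * (a21 * y + a31 * z) + b * (b21 * y + b31 * z)
          + c * (d1 * x + c21 * y + c31 * z))
       (a * (a32 * z) + b * (b32 * z) + c * (d2 * y + c32 * z))
       (c * (d3 * z)).
Proof.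
rewrite linmap_row3 add_lfunE [X in X + _]add_lfunE.
rewrite [X in X + _ + _]scale_lfunE [X in _ + X + _]scale_lfunE.
rewrite [X in _ + X]scale_lfunE !utE !row3Z !row3D; congr row3; ring.
Qed.

Lemma Dl_bracket_row3 l x1 x2 x3 y1 y2 y3 :
  Dl_bracket l (row3 x1 x2 x3) (row3 y1 y2 y3) =
  row3 (x3 * y1 - x1 * y3) (l * (x3 * y2 - x2 * y3)) 0.
Proof.
rewrite /Dl_bracket /table_product !big_cons big_nil /= !row3_coord row30.
by rewrite !row3E; congr row3; ring.
Qed.

(** The three groups of equations express the cocycle condition on [[e1, e2]],
    [[e3, e1]] and [[e3, e2]]. *)
Lemma bijective_cocycle_eqs l a21 a31 a32 b21 b31 b32 d1 d2 d3 c21 c31 c32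
    x1 y1 z1 x2 y2 z2 x3 y3 z3 :
  bijective_cocycle (Dl_bracket l)
    (linmap (ut 0 0 0 a21 a31 a32) (ut 0 0 0 b21 b31 b32)
            (ut d1 d2 d3 c21 c31 c32))
    (linmap (row3 x1 y1 z1) (row3 x2 y2 z2) (row3 x3 y3 z3)) ->
  [/\ det3 x1 y1 z1 x2 y2 z2 x3 y3 z3 != 0,
      a21 * y2 + a31 * z2 = b21 * y1 + b31 * z1 /\ a32 * z2 = b32 * z1,
      [/\ d1 * x1 + c21 * y1 + c31 * z1 - (a21 * y3 + a31 * z3) = x1,
          d2 * y1 + c32 * z1 - a32 * z3 = y1 & d3 * z1 = z1]
    & [/\ d1 * x2 + c21 * y2 + c31 * z2 - (b21 * y3 + b31 * z3) = l * x2,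
          d2 * y2 + c32 * z2 - b32 * z3 = l * y2 & d3 * z2 = l * z2]].
Proof.
case=> _ qc /linmap_bijective qb; split=> //.
- move: (qc (bvec K i1) (bvec K i2)).
  rewrite !bvec_row3 Dl_bracket_row3 !linmap_row3_row3 !rep_row3 row3N row3D.
  rewrite !(mul0r, mulr0, mul1r, mulr1, add0r, addr0, oppr0, subr0).
  by case/row3_inj=> /esym/eqP + /esym/eqP; rewrite !subr_eq0 => /eqP + /eqP.
- move: (qc (bvec K i3) (bvec K i1)).
  rewrite !bvec_row3 Dl_bracket_row3 !linmap_row3_row3 !rep_row3 row3N row3D.
  rewrite !(mul0r, mulr0, mul1r, mulr1, add0r, addr0, oppr0, subr0).
  by case/row3_inj=> <- <- <-.
move: (qc (bvec K i3) (bvec K i2)).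
rewrite !bvec_row3 Dl_bracket_row3 !linmap_row3_row3 !rep_row3 row3N row3D.
rewrite !(mul0r, mulr0, mul1r, mulr1, add0r, addr0, oppr0, subr0).
by case/row3_inj=> <- <- <-.
Qed.

Lemma table_product_cons i j w t (x y : 'rV[K]_3) :
  table_product ((i, j, w) :: t) x y =
  (x 0 i * y 0 j) *: w + table_product t x y.
Proof. by rewrite /table_product big_cons. Qed.

Lemma table_product_nil (x y : 'rV[K]_3) : table_product [::] x y = row3 0 0 0.
Proof. by rewrite /table_product big_nil row30. Qed.

Lemma representation_row3 l (f : rep K) :
  (forall a b c a' b' c' x y z,
     f (Dl_bracket l (row3 a b c) (row3 a' b' c')) (row3 x y z) =
     f (row3 a b c) (f (row3 a' b' c') (row3 x y z)) -
     f (row3 a' b' c') (f (row3 a b c) (row3 x y z))) ->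
  representation (Dl_bracket l) f.
Proof.
move=> fM x y; rewrite [x]row3_eta [y]row3_eta; apply: lfun_row3=> a b c.
by rewrite fM add_lfunE opp_lfunE !comp_lfunE.
Qed.

(** The linear map [e1 -> alpha e1], [e2 -> beta e2], [e3 -> e3 + u e1 + w e2]. *)
Definition dl_aut (alpha beta u w : K) : 'End('rV[K]_3) :=
  linmap (row3 alpha 0 0) (row3 0 beta 0) (row3 u w 1).

Lemma lie_automorphism_row3 l (T : 'End('rV[K]_3)) :
  bijective T ->
  (forall a b c x y z, T (Dl_bracket l (row3 a b c) (row3 x y z)) =
     Dl_bracket l (T (row3 a b c)) (T (row3 x y z))) ->
  lie_automorphism (Dl_bracket l) T.
Proof. by move=> bT TM; split=> // x y; rewrite [x]row3_eta [y]row3_eta. Qed.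

Lemma dl_aut_lie l alpha beta u w :
  alpha != 0 -> beta != 0 ->
  lie_automorphism (Dl_bracket l) (dl_aut alpha beta u w).
Proof.
move=> a0 b0; apply: lie_automorphism_row3=> [|a b c x y z].
  apply/linmap_bijective.
  by rewrite /det3 !(mul0r, mulr0, mulr1, subr0, addr0) mulf_neq0.
rewrite !Dl_bracket_row3 !linmap_row3_row3 Dl_bracket_row3; congr row3; ring.
Qed.

(** On the derived algebra spanned by [e1, e2] an automorphism conjugates
    [ad e3] to a multiple [z3 (ad e3)], so that [z3] multiplies the set of
    eigenvalues [{1, l}] into itself: either [z3 = 1], or [z3 = l = -1] and the
    eigenvectors are exchanged. *)
Lemma lie_automorphism_cases l (T : 'End('rV[K]_3)) :
  l != 0 -> l != 1 -> lie_automorphism (Dl_bracket l) T ->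
  (exists alpha beta u w : K,
     [/\ alpha != 0, beta != 0 & T = dl_aut alpha beta u w]) \/
  (exists alpha beta u w : K,
     [/\ alpha != 0, beta != 0, l = -1 &
         T = linmap (row3 0 alpha 0) (row3 beta 0 0) (row3 u w (-1))]).
Proof.
move=> l0 l1 [bT TM]; move: bT TM; rewrite [T]linmap_eta.
rewrite [T (bvec K i1)]row3_eta [T (bvec K i2)]row3_eta [T (bvec K i3)]row3_eta.
move: (T _ 0 i1) (T _ 0 i2) (T _ 0 i3) => x1 y1 z1.
move: (T _ 0 i1) (T _ 0 i2) (T _ 0 i3) => x2 y2 z2.
move: (T _ 0 i1) (T _ 0 i2) (T _ 0 i3) => x3 y3 z3.
move=> /linmap_bijective d0 TM.
move: (TM (bvec K i3) (bvec K i1)) (TM (bvec K i3) (bvec K i2)).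
rewrite {TM} !bvec_row3 !Dl_bracket_row3 !linmap_row3_row3 !Dl_bracket_row3.
case/row3_inj=> + + E13 => E11 E12; case/row3_inj=> E21 E22 E23.
have {}E13 : z1 = 0 by apply: (eq_of_sub E13); ring.
rewrite {z1}E13 in d0 E11 E12 E21 E22 E23 *.
have {}E23 : z2 = 0 by apply: (mulr_eq0r _ l0); apply: (eq_of_sub E23); ring.
rewrite {z2}E23 in d0 E11 E12 E21 E22 *.
have {}E11 : (z3 - 1) * x1 = 0 by apply: (eq_of_sub (esym E11)); ring.
have {}E12 : (l * z3 - 1) * y1 = 0 by apply: (eq_of_sub (esym E12)); ring.
have {}E21 : (z3 - l) * x2 = 0 by apply: (eq_of_sub (esym E21)); ring.
have {}E22 : (z3 - 1) * y2 = 0.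
  by apply: (mulr_eq0r _ l0); apply: (eq_of_sub (esym E22)); ring.
have {}d0 : z3 * (x1 * y2 - y1 * x2) != 0.
  by move: d0; congr (_ != 0); rewrite /det3; ring.
have [z31|z31] := eqVneq z3 1; [left|right].
  move: d0 E12 E21; rewrite z31 => d0 E12 E21.
  have y10 : y1 = 0 by apply: (mulr_eq0r E12); rewrite mulr1 subr_eq0.
  have x20 : x2 = 0 by apply: (mulr_eq0r E21); rewrite subr_eq0 eq_sym.
  exists x1, y2, x3, y3; rewrite y10 x20.
  by move: d0; rewrite y10 mul1r mul0r subr0 mulf_eq0 negb_or => /andP[].
have x10 : x1 = 0 by apply: (mulr_eq0r E11); rewrite subr_eq0.
have y20 : y2 = 0 by apply: (mulr_eq0r E22); rewrite subr_eq0.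
move: d0; rewrite x10 y20 mul0r sub0r mulrN oppr_eq0 !mulf_eq0 !negb_or.
case/and3P=> _ y10 x20.
have zl : z3 = l.
  apply/eqP; rewrite -subr_eq0; apply/eqP.
  by apply: (mulr_eq0r _ x20); rewrite mulrC.
have lm1 : l = -1.
  apply/eqP; rewrite -addr_eq0; apply/eqP.
  apply: (mulr_eq0r (a := l - 1)); last by rewrite subr_eq0.
  apply: (mulr_eq0r _ y10); apply: (eq_of_sub E12); rewrite zl; ring.
by exists y1, x2, x3, y3; rewrite zl lm1.
Qed.

Lemma cocycle_row3 l (f : rep K) (q : cochain K) :
  (forall a b c x y z,
     q (Dl_bracket l (row3 a b c) (row3 x y z)) =
     f (row3 a b c) (q (row3 x y z)) - f (row3 x y z) (q (row3 a b c))) ->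
  forall x y, q (Dl_bracket l x y) = f x (q y) - f y (q x).
Proof. by move=> qc x y; rewrite [x]row3_eta [y]row3_eta. Qed.

Lemma realises_row3 l (f : rep K) (q : cochain K) m :
  bijective q ->
  (forall a b c x y z, q (m (row3 a b c) (row3 x y z)) =
     f (row3 a b c) (q (row3 x y z))) ->
  realises (Dl_bracket l) f q m.
Proof.
move=> bq qm; split=> //; exists (\1%VF : 'End('rV[K]_3)) => [|x y].
  exact: lie_automorphism1.
by rewrite !id_lfunE [x]row3_eta [y]row3_eta.
Qed.

Lemma realises_dl_aut l (f : rep K) (q : cochain K) m alpha beta u w :
  alpha != 0 -> beta != 0 -> bijective q ->
  (forall a b c x y z, let T := dl_aut alpha beta u w in
     q (T (m (row3 a b c) (row3 x y z))) =
     f (T (row3 a b c)) (q (T (row3 x y z)))) ->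
  realises (Dl_bracket l) f q m.
Proof.
move=> a0 b0 bq qm; split=> //; exists (dl_aut alpha beta u w).
  exact: dl_aut_lie.
by move=> x y; rewrite [x]row3_eta [y]row3_eta qm.
Qed.

End Dl.

(** * The displayed cocycles *)

Section Listed.
Variable K : numClosedFieldType.

(** The values of [l] that would create coincidences between the eigenvalues in
    the classification are excluded. *)
Definition generic_weight (l : K) : Prop :=
  [/\ l != 0, l != 1, l != 2 & l != 3].

Lemma in_case_representation l cs (f : rep K) :
  in_case l cs f -> representation (Dl_bracket l) f.
Proof.
case: cs => /= [[a [b [c ->]]]|[a [c ->]]|[a ->]|[b [c ->]]|[c ->]|[c ->]|[c ->]
  |[c ->]|[c ->]|[-> [c ->]]|[_ [b [c ->]]]|[_ [c ->]]|[_ [c ->]]|[_ [c ->]]];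
  rewrite rep_ut; apply: representation_row3=> *;
  rewrite Dl_bracket_row3 !rep_row3 row3N row3D; congr row3; try ring; by field.
Qed.

Lemma listed_in_case l cs (f : rep K) q m : listed l cs f q m -> in_case l cs f.
Proof. by case=> * /=; do ?split; repeat eexists. Qed.

Lemma listed_bilinear l cs (f : rep K) q m : listed l cs f q m -> bilinear_op m.
Proof. by case=> *; apply: table_product_bilinear. Qed.

Lemma half_neq0 : 2^-1 != 0 :> K. Proof. by rewrite invr_eq0 pnatr_eq0. Qed.

Lemma mulr2n_sub1_neq0 (l : K) : l <> 2^-1 -> l *+ 2 - 1 != 0.
Proof.
move=> lh; apply/eqP=> E; apply: lh; apply: (mulIf (_ : 2 != 0)).
  by rewrite pnatr_eq0.
by rewrite mulr_natr mulVf ?pnatr_eq0 //; apply/eqP; rewrite -subr_eq0 E.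
Qed.

Lemma listed_bijective l cs (f : rep K) q m :
  generic_weight l -> listed l cs f q m -> bijective q.
Proof.
move=> [l0 l1 l2 _].
have n12 x y : x - y != 0 :> K -> y - x != 0 by rewrite -opprB oppr_eq0.
have l1' : 1 - l != 0 by rewrite subr_eq0 eq_sym.
have l2' : 2 - l != 0 by rewrite subr_eq0 eq_sym.
have nz := (l0, n12 _ _ l1', l1', n12 _ _ l2', l2', mulf_neq0, expf_neq0,
            half_neq0, oner_neq0).
case=> *; rewrite !row3E; apply/linmap_bijective; rewrite /det3;
  rewrite !(mulr0, mul0r, mulr1, mul1r, addr0, add0r, subr0, oppr0, sub0r);
  rewrite ?(mulrN, oppr_eq0) ?nz //;
  try exact/eqP; try exact: mulr2n_sub1_neq0; exact/n12/mulr2n_sub1_neq0.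
Qed.

Lemma listed_bijective_cocycle l cs (f : rep K) q m :
  generic_weight l -> listed l cs f q m ->
  bijective_cocycle (Dl_bracket l) f q.
Proof.
move=> gl H; split; last exact: listed_bijective H.
  exact/in_case_representation/(listed_in_case H).
have [l0 l1 _ _] := gl.
apply: cocycle_row3=> a b c x y z; case: {cs f q m gl} H => *; subst.
all: rewrite rep_ut !row3E Dl_bracket_row3.
all: rewrite !linmap_row3_row3 !rep_row3 row3N row3D.
all: congr row3; try ring; field; rewrite ?l0 ?subr_eq0 ?l1 //.
all: by rewrite eq_sym.
Qed.

Lemma listed_realises l cs (f : rep K) q m :
  generic_weight l -> listed l cs f q m -> realises (Dl_bracket l) f q m.
Proof.
move=> gl H; have bq := listed_bijective gl H; case: gl => l0 l1 l2 _.
case: {cs f q m} H bq => *; subst.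
(* The displayed table is the product of the displayed cocycle, except for
   [Dl_20], [Dhalf_S4] and [Dm1_T1]: there the products differ by a rescaling
   of e2 by [l^-1], a shift of e3 by 4 e1, and the sign of e2. *)
31: apply: (@realises_dl_aut _ _ _ _ _ 1 l^-1 0 0).
23: apply: (@realises_dl_aut _ _ _ _ _ 1 1 4 0).
11: apply: (@realises_dl_aut _ _ _ _ _ 1 (-1) 0 0).
all: try apply: realises_row3.
all: rewrite ?oppr_eq0 ?invr_eq0 ?oner_eq0 ?l0 //.
all: move=> a b c x y z /=.
all: rewrite rep_ut !table_product_cons table_product_nil !row3E.
all: rewrite !row3_coord !linmap_row3_row3 !rep_row3.
all: congr row3; try ring; field; rewrite ?l0 ?subr_eq0 ?l1 //.
all: by rewrite eq_sym.
Qed.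

End Listed.

(** * Normal forms of the bijective cocycles *)

Section Classification.
Variable K : numClosedFieldType.

Lemma mulr_eq0l (a b : K) : a * b = 0 -> b != 0 -> a = 0.
Proof. by rewrite mulrC; apply: mulr_eq0r. Qed.

Lemma cochainP (q : cochain K) :
  exists x1 y1 z1 x2 y2 z2 x3 y3 z3 : K,
    q = linmap (row3 x1 y1 z1) (row3 x2 y2 z2) (row3 x3 y3 z3).
Proof.
rewrite [q]linmap_eta [q (bvec K i1)]row3_eta [q (bvec K i2)]row3_eta.
by rewrite [q (bvec K i3)]row3_eta; do 9!eexists.
Qed.

(** The cocycle [q] of [f] is equivalent to a cocycle displayed for [f0] in the
    case [cs]. *)
Definition normalises l cs (f : rep K) (q : cochain K) (f0 : rep K) : Prop :=
  exists q0 m0, listed l cs f0 q0 m0 /\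
    cocycle_equivalent (Dl_bracket l) f q f0 q0.

(** The equivalence is given by the automorphism [dl_aut alpha beta u w] of the
    source; it suffices that it intertwines the displayed product. *)
Lemma normalises_row3 l cs (f f0 : rep K) (q q0 : cochain K) m0 alpha beta u w :
  generic_weight l -> listed l cs f0 q0 m0 ->
  bijective q -> alpha != 0 -> beta != 0 ->
  (forall a b c x y z, let T := dl_aut alpha beta u w in
     q (T (m0 (row3 a b c) (row3 x y z))) =
     f (T (row3 a b c)) (q (T (row3 x y z)))) ->
  normalises l cs f q f0.
Proof.
move=> gl lq0 bq a0 b0 qm; exists q0, m0; split=> //.
apply: (cocycle_equivalent_of_iso bq (listed_realises gl lq0)
  (dl_aut_lie l u w a0 b0)).
by move=> x y; rewrite [x]row3_eta [y]row3_eta qm.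
Qed.

(** [bijective_cocycle_eqs], as a principle for proving a property of all the
    bijective cocycles of a triangular representation. *)
Lemma cocycle_ind l (a21 a31 a32 b21 b31 b32 d1 d2 d3 c21 c31 c32 : K)
    (P : cochain K -> Prop) :
  (forall x1 y1 z1 x2 y2 z2 x3 y3 z3 : K,
     bijective (linmap (row3 x1 y1 z1) (row3 x2 y2 z2) (row3 x3 y3 z3)) ->
     det3 x1 y1 z1 x2 y2 z2 x3 y3 z3 != 0 ->
     a21 * y2 + a31 * z2 = b21 * y1 + b31 * z1 -> a32 * z2 = b32 * z1 ->
     d1 * x1 + c21 * y1 + c31 * z1 - (a21 * y3 + a31 * z3) = x1 ->
     d2 * y1 + c32 * z1 - a32 * z3 = y1 -> d3 * z1 = z1 ->
     d1 * x2 + c21 * y2 + c31 * z2 - (b21 * y3 + b31 * z3) = l * x2 ->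
     d2 * y2 + c32 * z2 - b32 * z3 = l * y2 -> d3 * z2 = l * z2 ->
     P (linmap (row3 x1 y1 z1) (row3 x2 y2 z2) (row3 x3 y3 z3))) ->
  forall q, bijective_cocycle (Dl_bracket l)
    (linmap (ut 0 0 0 a21 a31 a32) (ut 0 0 0 b21 b31 b32)
            (ut d1 d2 d3 c21 c31 c32)) q -> P q.
Proof.
move=> IH q.
have [x1 [y1 [z1 [x2 [y2 [z2 [x3 [y3 [z3 ->]]]]]]]]] := cochainP q.
move=> qc; have bq : bijective _ := let: And3 _ _ h := qc in h.
by have [d [A1 A2] [B1 B2 B3] [C1 C2 C3]] := bijective_cocycle_eqs qc; apply: IH.
Qed.

Lemma sqrt_exists (a : K) : a != 0 -> exists2 r : K, r != 0 & a = r ^+ 2.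
Proof.
by move=> a0; exists (sqrtC a); rewrite ?sqrtC_eq0 ?sqrtCK.
Qed.

Lemma cbrt_exists (a : K) : a != 0 -> exists2 r : K, r != 0 & a = r ^+ 3.
Proof.
by move=> a0; exists (3.-root a); rewrite ?rootC_eq0 ?rootCK.
Qed.

(* The goal is the equation H up to moving terms across the equality sign; with
   [lcf k H], up to the factor k as well. *)
Ltac lc H := by apply: (eq_of_sub H); ring.

Ltac lcf k H := by apply: (eq_of_sub (congr1 ( *%R k) H)); field.

Ltac nz :=
  rewrite ?(mulf_eq0, invr_eq0, oppr_eq0, oner_eq0, pnatr_eq0, negb_or);
  repeat (apply/andP; split); try assumption; try by [].

Ltac dl_check :=
  move=> ? ? ? ? ? ? /=;
  rewrite !table_product_cons table_product_nil !row3E;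
  rewrite !row3_coord !linmap_row3_row3 !rep_row3;
  congr row3; try ring; field.

(* Concludes with the displayed entry and the automorphism
   [dl_aut alpha beta u w], by a computation in coordinates. *)
Ltac normalise_by alpha beta u w entry :=
  match goal with gl : generic_weight _, bq : bijective _ |- _ =>
    apply: (@normalises_row3 _ _ _ _ _ _ _ alpha beta u w gl entry bq)
  end; [nz | nz | rewrite rep_ut; dl_check; nz].

Lemma generic_weight_half : generic_weight (2^-1 : K).
Proof.
split; rewrite -subr_eq0 ?subr0 ?half_neq0 //.
- by rewrite (_ : _ - _ = - 2^-1) ?oppr_eq0 ?half_neq0 //; field.
- by rewrite (_ : _ - _ = - (3 / 2)) ?oppr_eq0 ?mulf_neq0 ?half_neq0 ?pnatr_eq0 //; field.
by rewrite (_ : _ - _ = - (5 / 2)) ?oppr_eq0 ?mulf_neq0 ?half_neq0 ?pnatr_eq0 //; field.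
Qed.

(** If [q1] and [q2] are eigenvectors of [diag a b la] for 1 and [l] and
    [x1 * y2 * z3 != 0], then [a = 1], [b = l], and [q3] becomes an eigenvector
    for [la] after a correction along [q1] and [q2]. *)
Lemma eigen_complement l (la a b x1 x2 y1 y2 z1 z2 x3 y3 z3 : K) :
  l != 1 ->
  a * x1 = x1 -> b * y1 = y1 -> la * z1 = z1 ->
  a * x2 = l * x2 -> b * y2 = l * y2 -> la * z2 = l * z2 ->
  x1 * y2 * z3 != 0 ->
  [/\ a = 1, b = l & exists u w,
    [/\ a * (x3 + u * x1 + w * x2) = la * (x3 + u * x1 + w * x2),
        b * (y3 + u * y1 + w * y2) = la * (y3 + u * y1 + w * y2)
      & la * (z3 + u * z1 + w * z2) = la * (z3 + u * z1 + w * z2)]].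
Proof.
move=> l1 X1 Y1 Z1 X2 Y2 Z2; rewrite !mulf_eq0 !negb_or.
case/andP=> /andP[x10 y20] z30.
have l1a : l - 1 != 0 by rewrite subr_eq0.
have l1b : 1 - l != 0 by rewrite subr_eq0 eq_sym.
have X : (a - 1) * x1 = 0 by lc X1.
have Y : (b - l) * y2 = 0 by lc Y2.
have ? : a = 1 by lc (mulr_eq0l X x10).
have ? : b = l by lc (mulr_eq0l Y y20).
subst a b; split=> //; clear X1 Y2 X Y.
have ? : y1 = 0 by apply: mulr_eq0r l1a; lc Y1.
have ? : x2 = 0 by apply: mulr_eq0r l1b; lc X2.
subst y1 x2.
(* No correction is made along the eigenvector of eigenvalue [la], whose third
   coordinate may be nonzero. *)
have [lm1|lm1] := eqVneq la 1.
  by exists 0, (- (y3 / y2)); subst la; split; field; nz.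
have [lml|lml] := eqVneq la l.
  by exists (- (x3 / x1)), 0; subst la; split; field; nz.
by exists (- (x3 / x1)), (- (y3 / y2)); split; field; nz.
Qed.

(** The roles of the three coordinates may be permuted, so that the target is
    the diagonal representation whose third entry completes the trace. *)
Lemma normalise_AI l a b c (q : cochain K) :
  generic_weight l -> bijective_cocycle (Dl_bracket l) (repAI a b c) q ->
  normalises l AI (repAI a b c) q (repAI 1 l (a + b + c - 1 - l)).
Proof.
move=> gl; have [l0 l1 _ _] := gl; rewrite {1}repAI_ut; move: q.
apply: cocycle_ind => x1 y1 z1 x2 y2 z2 x3 y3 z3 bq d _ _ B1 B2 B3 C1 C2 C3.
have {}B1 : a * x1 = x1 by lc B1.
have {}B2 : b * y1 = y1 by lc B2.
have {}C1 : a * x2 = l * x2 by lc C1.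
have {}C2 : b * y2 = l * y2 by lc C2.
suff [u [w [X Y Z]]] : exists u w : K, let la := a + b + c - 1 - l in
    [/\ a * (x3 + u * x1 + w * x2) = la * (x3 + u * x1 + w * x2),
        b * (y3 + u * y1 + w * y2) = la * (y3 + u * y1 + w * y2)
      & c * (z3 + u * z1 + w * z2) = la * (z3 + u * z1 + w * z2)].
  apply: (normalises_row3 (alpha := 1) (beta := 1) (u := u) (w := w) gl
    (Dl_1 l _) bq); rewrite ?oner_eq0 // => a1 a2 a3 b1 b2 b3.
  rewrite /= repAI_ut !table_product_cons table_product_nil !row3E.
  rewrite !row3_coord !linmap_row3_row3 !rep_row3.
  have key (d' r1 r2 r3 : K) : d' * r1 = r1 -> d' * r2 = l * r2 ->
      d' * (r3 + u * r1 + w * r2) =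
        (a + b + c - 1 - l) * (r3 + u * r1 + w * r2) ->
      a3 * (d' * (b1 * r1 + b2 * r2 + b3 * (r3 + u * r1 + w * r2))) =
      a3 * (b1 * r1 + l * b2 * r2
            + b3 * ((a + b + c - 1 - l) * (r3 + u * r1 + w * r2))).
    by move=> E1 E2 <-; rewrite !mulrDr ![d' * (_ * _)]mulrCA E1 E2; ring.
  by congr row3;
     [apply: (eq_of_sub (esym (key _ _ _ _ B1 C1 X)))
     |apply: (eq_of_sub (esym (key _ _ _ _ B2 C2 Y)))
     |apply: (eq_of_sub (esym (key _ _ _ _ B3 C3 Z)))]; ring.
(* Some term of the Leibniz expansion of the determinant does not vanish. *)
have det_terms : [|| x1 * y2 * z3 != 0, x1 * z2 * y3 != 0, y1 * x2 * z3 != 0,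
    y1 * z2 * x3 != 0, z1 * x2 * y3 != 0 | z1 * y2 * x3 != 0].
  apply: contraNT d; rewrite !negb_or !negbK.
  case/and5P=> /eqP t1 /eqP t2 /eqP t3 /eqP t4 /andP[/eqP t5 /eqP t6].
  have -> : det3 x1 y1 z1 x2 y2 z2 x3 y3 z3 = x1 * y2 * z3 - x1 * z2 * y3
      - y1 * x2 * z3 + y1 * z2 * x3 + z1 * x2 * y3 - z1 * y2 * x3.
    by rewrite /det3; ring.
  by rewrite t1 t2 t3 t4 t5 t6 !(subr0, addr0).
case/or4P: det_terms; last case/or3P.
- case/(eigen_complement x3 y3 l1 B1 B2 B3 C1 C2 C3)=> a1 bl [u [w [X Y Z]]].
  by exists u, w; have -> : a + b + c - 1 - l = c by rewrite a1 bl; ring.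
- case/(eigen_complement x3 z3 l1 B1 B3 B2 C1 C3 C2)=> a1 bl [u [w [X Y Z]]].
  by exists u, w; have -> : a + b + c - 1 - l = b by rewrite a1 bl; ring.
- case/(eigen_complement y3 x3 l1 B2 B1 B3 C2 C1 C3)=> a1 bl [u [w [X Y Z]]].
  by exists u, w; have -> : a + b + c - 1 - l = c by rewrite a1 bl; ring.
- case/(eigen_complement y3 z3 l1 B2 B3 B1 C2 C3 C1)=> a1 bl [u [w [X Y Z]]].
  by exists u, w; have -> : a + b + c - 1 - l = a by rewrite a1 bl; ring.
- case/(eigen_complement z3 x3 l1 B3 B1 B2 C3 C1 C2)=> a1 bl [u [w [X Y Z]]].
  by exists u, w; have -> : a + b + c - 1 - l = b by rewrite a1 bl; ring.
case/(eigen_complement z3 y3 l1 B3 B2 B1 C3 C2 C1)=> a1 bl [u [w [X Y Z]]].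
by exists u, w; have -> : a + b + c - 1 - l = a by rewrite a1 bl; ring.
Qed.

(** The displayed families correspond to: [Dl_7] and the 1/2-family for
    [z1 = 0], according to [y2 = 0] or not; [Dl_4] and [Dl_5] for [z1 != 0] and
    [y2 = 0]; [Dl_6] for [z1 != 0] and [y2 != 0]. *)
Lemma normalise_AIV l b c (q : cochain K) :
  generic_weight l -> bijective_cocycle (Dl_bracket l) (repAIV l b c) q ->
  normalises l AIV (repAIV l b c) q (repAIV l b c).
Proof.
move=> gl; have [l0 l1 _ _] := gl.
rewrite {1}repAIV_ut; move: q; apply: cocycle_ind.
move=> x1 y1 z1 x2 y2 z2 x3 y3 z3 bq d A1 _ B1 _ B3 C1 C2 C3.
have ? : y1 = 0 by lc (esym A1).
subst y1.
have {A1}B1 : (b + l - 1) * x1 = 0 by lc B1.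
have {}B3 : (c - 1) * z1 = 0 by lc B3.
have ? : y3 = b * x2 by lc (esym C1).
subst y3.
have {C1}C2 : (b - l) * y2 = 0 by lc C2.
have {}C3 : (c - l) * z2 = 0 by lc C3.
have {}d : x1 * (y2 * z3 - z2 * (b * x2)) + z1 * (x2 * (b * x2) - y2 * x3) != 0.
  by move: d; congr (_ != 0); rewrite /det3; ring.
have [?|z10] := eqVneq z1 0.
  subst z1; have {d B3} : x1 * (y2 * z3 - z2 * (b * x2)) != 0.
    by move: d; rewrite mul0r addr0.
  rewrite mulf_eq0 negb_or => /andP[x10 d].
  have ? : b = 1 - l by lc (mulr_eq0l B1 x10).
  subst b; have [?|y20] := eqVneq y2 0.
    subst y2; move: d; rewrite mul0r sub0r oppr_eq0 !mulf_eq0 !negb_or.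
    case/and3P=> z20 l1' x20; have ? : c = l by lc (mulr_eq0l C3 z20).
    subst c; normalise_by ((1 - l) * x2 / x1) (1 : K)
      ((z3 / z2 * x2 / l - x3) / x1) (- (z3 / z2)) (Dl_7 l).
  have ? : l = 2^-1 by lcf (- 2^-1 : K) (mulr_eq0l C2 y20).
  subst l; have {C3} : (z2 == 0) || (c - 2^-1 == 0).
    by rewrite orbC -mulf_eq0 C3.
  have S1 := Dhalf_S1 c (erefl (2^-1 : K)).
  have h2 : 1 - 2^-1 = 2^-1 :> K by field.
  rewrite h2 in bq *.
  by case/orP=> [/eqP ? | ]; last rewrite subr_eq0 => /eqP ?; subst;
    normalise_by (y2 / x1) (1 : K)
      ((x2 * x2 / y2 / 2 - x3) / x1) (- (x2 / y2 / 2)) S1.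
have ? : c = 1 by lc (mulr_eq0l B3 z10).
subst c; have ? : z2 = 0.
  by apply: (mulr_eq0r C3); rewrite subr_eq0 eq_sym.
subst z2; have [?|y20] := eqVneq y2 0.
  subst y2; have {d} : z1 * (x2 * (b * x2)) != 0.
    by move: d; congr (_ != 0); ring.
  rewrite !mulf_eq0 !negb_or => /and4P[_ x20 b0 _].
  have : (b + l - 1 == 0) || (x1 == 0) by rewrite -mulf_eq0 B1.
  have [|bl] := eqVneq (l + b) 0.
    move=> /eqP; rewrite addrC addr_eq0 => /eqP ?; subst b.
    case/orP=> [|/eqP ?]; first by rewrite addNr sub0r oppr_eq0 oner_eq0.
    subst x1; have [?|x30] := eqVneq x3 0.
      subst x3; normalise_by (1 : K) (1 : K) (- (z3 / z1)) (0 : K)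
        (Dl_4 l (elimN eqP b0)).
    normalise_by (1 : K) (l * x3 / x2) (- (z3 / z1)) (0 : K) (Dl_5 l).
  case/orP=> [E|/eqP ?]; last first.
    subst x1; normalise_by (1 : K) (1 : K) (- (z3 / z1))
      (- (l * x3 / ((l + b) * x2))) (Dl_4 l (elimN eqP b0)).
  have ? : b = 1 - l by lc (eqP E).
  subst b; normalise_by (1 : K) (1 : K) (- (z3 / z1))
    (- (l * (x3 - x1 * z3 / z1) / x2)) (Dl_4 l (elimN eqP b0)).
have ? : b = l by lc (mulr_eq0l C2 y20).
(* The vector e3, corrected by u and w, is sent to [X v1]. *)
subst b; pose X := x3 - l * x2 * x2 / y2 - x1 * z3 / z1.
have X0 : X != 0.
  apply: contraNneq d => X0; apply/eqP.
  by apply: (eq_of_sub (congr1 ( *%R (- (z1 * y2))) X0)); rewrite /X; field; nz.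
have [r r0 rE] := sqrt_exists (mulf_neq0 X0 (invr_neq0 y20)).
have {rE d X0} ? : x3 = r ^+ 2 * y2 + l * x2 * x2 / y2 + x1 * z3 / z1.
  by rewrite -rE /X; field; nz.
subst x3; have : (l + l - 1 == 0) || (x1 == 0) by rewrite -mulf_eq0 B1.
case/orP=> [E|/eqP ?]; last first.
  subst x1; normalise_by (1 : K) r (- (z3 / z1)) (- (l * x2 / y2)) (Dl_6 l).
have ? : l = 2^-1 by lcf (2^-1 : K) (eqP E).
subst l; normalise_by (1 : K) r (- (z3 / z1)) (- (x2 / y2 / 2))
  (Dl_6 (2^-1 : K)).
Qed.

Lemma normalise_AII l a c (q : cochain K) :
  generic_weight l -> bijective_cocycle (Dl_bracket l) (repAII a c) q ->
  normalises l AII (repAII a c) q (repAII a c).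
Proof.
move=> gl; have [l0 l1 _ _] := gl.
have l1a : l - 1 != 0 by rewrite subr_eq0.
have l1b : 1 - l != 0 by rewrite subr_eq0 eq_sym.
rewrite {1}repAII_ut; move: q; apply: cocycle_ind.
move=> x1 y1 z1 x2 y2 z2 x3 y3 z3 bq d _ _ B1 B2 B3 C1 C2 C3.
have y1E : y1 = (1 - a) * x1 by lc B1.
have y2E : y2 = (l - a) * x2 by lc C1.
have {}B2 : (1 - a) * y1 = 0 by lc (esym B2).
have {}C2 : (l - a) * y2 = 0 by lc (esym C2).
have {}B3 : (c - 1) * z1 = 0 by lc B3.
have {}C3 : (c - l) * z2 = 0 by lc C3.
have h1 : y1 = 0.
  by move/eqP: B2; rewrite mulf_eq0 => /orP[/eqP E|/eqP//]; rewrite y1E E mul0r.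
have h2 : y2 = 0.
  by move/eqP: C2; rewrite mulf_eq0 => /orP[/eqP E|/eqP//]; rewrite y2E E mul0r.
rewrite h1 in y1E; rewrite h2 in y2E; subst y1 y2.
have {}d : y3 * (z1 * x2 - x1 * z2) != 0.
  by move: d; congr (_ != 0); rewrite /det3; ring.
move: d; rewrite mulf_eq0 negb_or => /andP[y30 d].
have [?|x10] := eqVneq x1 0.
  subst x1; move: d; rewrite mul0r subr0 mulf_eq0 negb_or => /andP[z10 x20].
  have ? : c = 1 by lc (mulr_eq0l B3 z10).
  have ? : a = l by lc (esym (mulr_eq0l (esym y2E) x20)).
  subst a c; have ? : z2 = 0 by apply: mulr_eq0r C3 _.
  subst z2; normalise_by (1 : K) (y3 / x2) (- (z3 / z1)) (0 : K) (Dl_2 l).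
have ? : a = 1 by lc (esym (mulr_eq0l (esym y1E) x10)).
subst a; have ? : x2 = 0 by apply: mulr_eq0r (esym y2E) _.
subst x2; move: d; rewrite mulr0 sub0r oppr_eq0 mulf_eq0 negb_or.
case/andP=> _ z20; have ? : c = l by lc (mulr_eq0l C3 z20).
subst c; have ? : z1 = 0 by apply: mulr_eq0r B3 _.
subst z1; normalise_by (y3 / x1) (1 : K) (0 : K) (- (z3 / z2)) (Dl_3 l).
Qed.

(** A single Jordan block has only one eigenvalue, while 1 and [l] both have to
    occur. *)
Lemma cocycle_AIII l a (q : cochain K) :
  l != 1 -> ~ bijective_cocycle (Dl_bracket l) (repAIII a) q.
Proof.
move=> l1; rewrite repAIII_ut; move: q; apply: cocycle_ind.
move=> x1 y1 z1 x2 y2 z2 x3 y3 z3 _ d _ _ B1 B2 B3 C1 C2 C3.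
have kernel (t x y z : K) : t != a -> a * z = t * z -> a * y + z = t * y ->
    a * x + y = t * x -> [/\ x = 0, y = 0 & z = 0].
  move=> ta Z Y X; have ta0 : t - a != 0 by rewrite subr_eq0.
  have z0 : z = 0 by apply: mulr_eq0r ta0; lc (esym Z).
  have y0 : y = 0 by apply: mulr_eq0r ta0; rewrite z0 in Y; lc (esym Y).
  by split=> //; apply: mulr_eq0r ta0; rewrite y0 in X; lc (esym X).
have [E|la] := eqVneq l a.
  have [||||? ? ?] := @kernel 1 x1 y1 z1.
  - by rewrite -E eq_sym.
  - lc B3.
  - lc B2.
  - lc B1.
  by case/eqP: d; subst x1 y1 z1; rewrite /det3; ring.
have [||||? ? ?] := @kernel l x2 y2 z2; rewrite ?la //.
- lc C2.
- lc C1.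
by case/eqP: d; subst x2 y2 z2; rewrite /det3; ring.
Qed.

Lemma normalise_AV l c (q : cochain K) :
  generic_weight l -> bijective_cocycle (Dl_bracket l) (repAV l c) q ->
  normalises l AV (repAV l c) q (repAV l c).
Proof.
move=> gl; have [l0 l1 _ _] := gl.
have l1b : 1 - l != 0 by rewrite subr_eq0 eq_sym.
rewrite {1}repAV_ut; move: q; apply: cocycle_ind.
move=> x1 y1 z1 x2 y2 z2 x3 y3 z3 bq d A1 _ B1 _ B3 C1 C2 C3.
have ? : y1 = 0 by lc (esym A1).
have z1E : z1 = (1 - c) * x1 by lc B1.
have {}B3 : (1 - c) * z1 = 0 by lc (esym B3).
have h1 : z1 = 0.
  by move/eqP: B3; rewrite mulf_eq0 => /orP[/eqP E|/eqP//]; rewrite z1E E mul0r.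
rewrite h1 in z1E; subst y1 z1.
have {}d : x1 * (y2 * z3 - z2 * y3) != 0.
  by move: d; congr (_ != 0); rewrite /det3; ring.
move: d; rewrite mulf_eq0 negb_or => /andP[x10 d].
have ? : c = 1 by lc (esym (mulr_eq0l (esym z1E) x10)).
subst c; have ? : z2 = 0 by apply: mulr_eq0r l1b; lc C3.
subst z2; move: d; rewrite mul0r subr0 mulf_eq0 negb_or => /andP[y20 z30].
have ? : l = 2^-1.
  have E : (1 - l - l) * y2 = 0 by lc C2.
  by lcf (- 2^-1 : K) (mulr_eq0l E y20).
subst l; have ? : y3 = x2 / 2 by lcf (-1 : K) C1.
subst y3; have [r r0 rE] := sqrt_exists (mulf_neq0 z30 (invr_neq0 y20)).
have ? : z3 = r ^+ 2 * y2 by rewrite -rE; field; nz.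
subst z3; normalise_by (r ^+ 2 * y2 / x1) r (0 : K) (- (x2 / y2 / 2))
  (Dhalf_S2 (erefl (2^-1 : K))).
Qed.

(** [Dhalf_S3] arises for [x1 = 0], [Dl_8] and [Dm1_T1] for [x1 != 0]. *)
Lemma normalise_AVI l c (q : cochain K) :
  generic_weight l -> bijective_cocycle (Dl_bracket l) (repAVI l c) q ->
  normalises l AVI (repAVI l c) q (repAVI l c).
Proof.
move=> gl; have [l0 l1 _ _] := gl.
have l1b : 1 - l != 0 by rewrite subr_eq0 eq_sym.
rewrite {1}repAVI_ut; move: q; apply: cocycle_ind.
move=> x1 y1 z1 x2 y2 z2 x3 y3 z3 bq d _ A2 B1 B2 _ C1 C2 C3.
have ? : z1 = 0 by lc (esym A2).
have z2E : z2 = (l - c) * x2 by lc C1.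
have {}C3 : (l - c) * z2 = 0 by lc (esym C3).
have h2 : z2 = 0.
  by move/eqP: C3; rewrite mulf_eq0 => /orP[/eqP E|/eqP//]; rewrite z2E E mul0r.
have ? : z3 = c * y2 by lc (esym C2).
rewrite h2 in z2E; subst z1 z2 z3.
have {}d : c * y2 * (x1 * y2 - x2 * y1) != 0.
  by move: d; congr (_ != 0); rewrite /det3; ring.
move: d; rewrite !mulf_eq0 !negb_or => /andP[/andP[c0 y20] d].
have {}B1 : (c - 1) * x1 = 0 by lc B1.
have {}B2 : (c + l - 1) * y1 = 0 by lc B2.
have [?|x10] := eqVneq x1 0.
  subst x1; move: d; rewrite mul0r sub0r oppr_eq0 mulf_eq0 negb_or.
  case/andP=> x20 y10; have ? : c = l by lcf (-1 : K) (mulr_eq0l (esym z2E) x20).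
  subst c; have ? : l = 2^-1 by lcf (2^-1 : K) (mulr_eq0l B2 y10).
  subst l; normalise_by (y2 ^+ 2 / (4 * x2 * y1)) (y2 / x2 / 2)
    ((y2 ^+ 2 / x2 - y3) / y1) (0 : K) (Dhalf_S3 (erefl (2^-1 : K))).
have ? : c = 1 by lc (mulr_eq0l B1 x10).
subst c; have ? : x2 = 0.
  by apply: mulr_eq0r (esym z2E) _; rewrite subr_eq0.
have ? : y1 = 0 by apply: mulr_eq0r l0; lc B2.
subst x2 y1; have [/eqP|lm1] := eqVneq (1 + l) 0.
  rewrite addrC addr_eq0 => /eqP ?; subst l; have [?|y30] := eqVneq y3 0.
    subst y3; normalise_by (y2 / x1) (1 : K) (0 : K) (0 : K) (Dl_8 (-1 : K)).
  normalise_by (y2 / x1) (- (y3 / y2)) (0 : K) (0 : K)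
    (Dm1_T1 (erefl (-1 : K))).
normalise_by (y2 / x1) (1 : K) (0 : K) (- (l * y3 / (y2 * (1 + l)))) (Dl_8 l).
Qed.

(** [Dnhalf_S1] arises for [z2 = 0] and [Dthird_T1] for [z2 != 0]. *)
Lemma normalise_AVII l c (q : cochain K) :
  generic_weight l -> bijective_cocycle (Dl_bracket l) (repAVII l c) q ->
  normalises l AVII (repAVII l c) q (repAVII l c).
Proof.
move=> gl; have [l0 l1 _ _] := gl.
rewrite {1}repAVII_ut; move: q; apply: cocycle_ind.
move=> x1 y1 z1 x2 y2 z2 x3 y3 z3 bq d A1 A2 B1 _ _ C1 C2 C3.
have ? : z1 = 0 by lc (esym A2).
subst z1; have ? : y1 = 0 by lc (esym A1).
subst y1; have {}d : x1 * (y2 * z3 - z2 * y3) != 0.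
  by move: d; congr (_ != 0); rewrite /det3; ring.
move: d; rewrite mulf_eq0 negb_or => /andP[x10 d].
have {}B1 : (c + l *+ 2 - 1) * x1 = 0 by lc B1.
have ? : c = 1 - l *+ 2 by lc (mulr_eq0l B1 x10).
subst c; have ? : y3 = (1 - l) * x2 by lc (esym C1).
have ? : z3 = (1 - l *+ 2) * y2 by lc (esym C2).
subst y3 z3; have [?|z20] := eqVneq z2 0.
  subst z2; move: d; rewrite mul0r subr0 !mulf_eq0 !negb_or.
  case/and3P=> y20 lh _.
  have lN : l <> 2^-1.
    by move=> E; case/eqP: lh; rewrite E; field.
  normalise_by (y2 / x1) (1 : K) ((x2 ^+ 2 / (2 * y2) - x3) / x1)
    (- (l * x2 / y2)) (Dnhalf_S1 lN).
have E : (1 - l *+ 2 - l) * z2 = 0 by lc C3.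
have ? : l = 3^-1 by lcf (- 3^-1 : K) (mulr_eq0l E z20).
(* With [w] chosen to kill its third coordinate, e3 is sent to [_ v1 + Y v2]. *)
subst l; pose Y := 2 / 3 * x2 - y2 ^+ 2 / (3 * z2).
have Y0 : Y != 0.
  apply: contraNneq d => Y0; apply/eqP.
  by apply: (eq_of_sub (congr1 ( *%R (- z2)) Y0)); rewrite /Y; field; nz.
have [r r0 rE] := sqrt_exists (mulf_neq0 Y0 (invr_neq0 z20)).
have ? : x2 = 3 / 2 * (r ^+ 2 * z2 + y2 ^+ 2 / (3 * z2)).
  by rewrite -rE /Y; field; nz.
clear d E C1 C2 C3 rE Y0 Y; subst x2.
normalise_by (r ^+ 3 * z2 / x1) r
  ((r ^+ 2 * y2 - x3
    + y2 / (3 * z2) * (3 / 2 * (r ^+ 2 * z2 + y2 ^+ 2 / (3 * z2)))) / x1)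
  (- (y2 / (3 * z2))) (Dthird_T1 (erefl (3^-1 : K))).
Qed.

(** [Dl_10] arises for [z1 != 0]; for [z1 = 0], [Dnhalf_S2] if [y1 = 0] and [Dl_9]
    otherwise. *)
Lemma normalise_BI l c (q : cochain K) :
  generic_weight l -> bijective_cocycle (Dl_bracket l) (repBI l c) q ->
  normalises l BI (repBI l c) q (repBI l c).
Proof.
move=> gl; have [l0 l1 l2 _] := gl.
have l1b : l - 1 != 0 by rewrite subr_eq0.
rewrite {1}repBI_ut; move: q; apply: cocycle_ind.
move=> x1 y1 z1 x2 y2 z2 x3 y3 z3 bq d A1 _ B1 B2 B3 C1 _ C3.
have ? : y2 = z1 by lc A1.
have ? : y3 = (c + l - 1) * x1 by lc (esym B1).
have ? : z3 = c * x2 by lc (esym C1).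
have {}B2 : (c + l - 2) * y1 = 0 by lc B2.
have {}B3 : (c - 1) * z1 = 0 by lc B3.
have {}C3 : (c - l) * z2 = 0 by lc C3.
clear A1 B1 C1; subst y2 y3 z3.
have [?|z10] := eqVneq z1 0; last first.
  have ? : c = 1 by lc (mulr_eq0l B3 z10).
  subst c; have ? : z2 = 0.
    by apply: mulr_eq0r C3 _; rewrite subr_eq0 eq_sym.
  have ? : y1 = 0 by apply: mulr_eq0r l1b; lc B2.
  subst z2 y1; have [X XE] : exists X, X = x3 - (1 + l) * x1 * x2 / z1.
    by exists (x3 - (1 + l) * x1 * x2 / z1).
  have ? : x3 = X + (1 + l) * x1 * x2 / z1 by rewrite XE; field; nz.
  clear XE; subst x3; have X0 : X != 0.
    by apply: contraNneq d => ->; apply/eqP; rewrite /det3; field; nz.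
  normalise_by (1 : K) (X / z1) (- (x2 / z1)) (- (l * x1 / z1)) (Dl_10 l).
subst z1; have [?|y10] := eqVneq y1 0.
  subst y1; have {}d : z2 * ((c + l - 1) * x1 * x1) != 0.
    by apply: contraNneq d => E; apply/eqP; rewrite /det3; lcf (-1 : K) E.
  move: d; rewrite !mulf_eq0 !negb_or => /and3P[z20 /andP[lh x10] _].
  have ? : c = l by lc (mulr_eq0l C3 z20).
  subst c; have lN : l <> 2^-1 by move=> E; case/eqP: lh; rewrite E; field.
  normalise_by (z2 / x1) (1 : K) (- ((x3 - l * x2 ^+ 2 / z2) / (2 * l * x1)))
    (- (l * x2 / z2)) (Dnhalf_S2 lN).
have ? : c = 2 - l by lc (mulr_eq0l B2 y10).
subst c; have ? : z2 = 0 by apply: mulr_eq0r l1b; lcf (- 2^-1 : K) C3.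
subst z2; have x20 : x2 != 0.
  by apply: contraNneq d => ->; apply/eqP; rewrite /det3; ring.
normalise_by (1 : K) (y1 / x2) (- (x1 / y1))
  (- (l * (x3 - x1 ^+ 2 / y1) / (2 * x2))) (Dl_9 l).
Qed.

(** Here [q e1 = (x1, p, 0)] and [q e2 = (p, y2, 0)], with [c = 1 - l] if
    [x1 != 0] ([Dl_15]) and [c = l - 1] if [y2 != 0] ([Dl_14], [Dhalf_S4]).  If
    both vanish, the components of [e3 * e3] along [e1] and [e2] can be removed
    unless [c = -1], respectively [c = - l] ([Dl_11], [Dl_12], [Dl_13]). *)
Lemma normalise_BII l c (q : cochain K) :
  generic_weight l -> bijective_cocycle (Dl_bracket l) (repBII l c) q ->
  normalises l BII (repBII l c) q (repBII l c).
Proof.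
move=> gl; have [l0 l1 l2 _] := gl.
have l1a : l - 1 != 0 by rewrite subr_eq0.
have l1b : 1 - l != 0 by rewrite subr_eq0 eq_sym.
have l2b : 2 - l != 0 by rewrite subr_eq0 eq_sym.
rewrite {1}repBII_ut; move: q; apply: cocycle_ind.
move=> x1 y1 z1 x2 y2 z2 x3 y3 z3 bq d A1 A2 B1 B2 _ C1 C2 _.
have ? : z1 = 0 by lc (esym A1).
subst z1; have ? : z2 = 0 by lc A2.
subst z2; have ? : z3 = c * y1 by lc (esym B2).
subst z3; have {}d : c * y1 * (x1 * y2 - x2 * y1) != 0.
  by move: d; congr (_ != 0); rewrite /det3; ring.
move: d; rewrite !mulf_eq0 !negb_or => /andP[/andP[c0 p0] _].
have ? : x2 = y1.
  have E : c * (x2 - y1) = 0 by lc C1.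
  by lc (mulr_eq0r E c0).
have {}B1 : (c + l - 1) * x1 = 0 by lc B1.
have {}C2 : (c + 1 - l) * y2 = 0 by lc C2.
clear A1 A2 C1 B2; subst x2; move: y1 => p in bq p0 *.
have c0' := elimN eqP c0.
have [?|x10] := eqVneq x1 0; last first.
  have ? : c = 1 - l by lc (mulr_eq0l B1 x10).
  subst c; have ? : y2 = 0 by apply: mulr_eq0r l1b; lcf (2^-1 : K) C2.
  subst y2; normalise_by (1 : K) (- ((1 - l) * x1 / p)) (- (y3 / p / (2 - l)))
    (- ((l * x3 - y3 * x1 / p) / p)
     - 2 * (y3 / p / (2 - l)) * (1 - l) * x1 / p) (Dl_15 l).
subst x1; have [?|y20] := eqVneq y2 0; last first.
  have ? : c = l - 1 by lc (mulr_eq0l C2 y20).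
  subst c; have [lh|lh] := eqVneq (2 * l - 1) 0.
    have ? : l = 2^-1 by lcf (2^-1 : K) lh.
    subst l; have [?|x30] := eqVneq x3 0.
      subst x3; normalise_by (y2 / p / 2) (1 : K) (- (2 * y3 / p)) (0 : K)
        (Dl_14 (2^-1 : K)).
    have h2 : 2^-1 - 1 = - 2^-1 :> K by field.
    rewrite h2 in bq *.
    normalise_by (x3 / p / 2 * (y2 / p / 2)) (x3 / p / 2)
      (- (2 * y3 / p - x3 * y2 / p ^+ 2)) (0 : K)
      (Dhalf_S4 (erefl (2^-1 : K))).
  normalise_by ((1 - l) * y2 / p) (1 : K)
    (- ((y3 / p - l * x3 * y2 / p ^+ 2
         - 2 * (l * x3 / (p * (2 * l - 1))) * (1 - l) * y2 / p) / l))
    (- (l * x3 / (p * (2 * l - 1)))) (Dl_14 l).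
subst y2; have [/eqP|c1] := eqVneq (c + 1) 0.
  rewrite addr_eq0 => /eqP ?; subst c; have [?|y30] := eqVneq y3 0.
    subst y3; normalise_by (1 : K) (1 : K) (0 : K)
      (- (l * x3 / (p * (l - 1)))) (Dl_11 l c0').
  normalise_by (y3 / p) (1 : K) (0 : K) (- (l * x3 / (p * (l - 1)))) (Dl_12 l).
have [/eqP|cl] := eqVneq (c + l) 0.
  rewrite addr_eq0 => /eqP ?; subst c; have [?|x30] := eqVneq x3 0.
    subst x3; normalise_by (1 : K) (1 : K) (- (y3 / (p * (1 - l)))) (0 : K)
      (Dl_11 l c0').
  normalise_by (1 : K) (l * x3 / p) (- (y3 / (p * (1 - l)))) (0 : K) (Dl_13 l).
normalise_by (1 : K) (1 : K) (- (y3 / (p * (c + 1))))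
  (- (l * x3 / (p * (c + l)))) (Dl_11 l c0').
Qed.

(** [Dhalf_S7] arises for [y1 != 0], [Dhalf_S5] and [Dhalf_S6] for [y1 = 0]. *)
Lemma normalise_BIII (c : K) (q : cochain K) :
  bijective_cocycle (Dl_bracket 2^-1) (repBIII c) q ->
  normalises 2^-1 BIII (repBIII c) q (repBIII c).
Proof.
have gl := generic_weight_half.
rewrite {1}repBIII_ut; move: q; apply: cocycle_ind.
move=> x1 y1 z1 x2 y2 z2 x3 y3 z3 bq d A1 A2 B1 B2 _ C1 C2 _.
have ? : z1 = 0 by lc (esym A2).
subst z1; have ? : z2 = y1 by lc A1.
have ? : z3 = c * x1 by lc (esym B1).
have ? : y3 = (c + 2^-1) * x2 by lcf (-1 : K) C1.
subst z2 y3 z3.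
have {}C2 : c * (y2 - x1) = 0 by lcf (1 : K) C2.
have {}B2 : (c - 2^-1) * y1 = 0 by lcf (1 : K) B2.
clear A1 A2 B1 C1; have [?|y10] := eqVneq y1 0; last first.
  have ? : c = 2^-1 by lc (mulr_eq0l B2 y10).
  subst c; have ? : y2 = x1 by lcf (2 : K) C2.
  clear C2 B2; subst y2.
  have [X XE] : exists X, X = x3 - 3 / 2 * x1 * x2 / y1
                              + x1 ^+ 3 / (2 * y1 ^+ 2) by eexists.
  have X0 : X != 0.
    apply: contraNneq d => X0; apply/eqP.
    apply: (eq_of_sub (congr1 ( *%R (y1 ^+ 2)) X0)); rewrite XE /det3.
    by field; nz.
  have [r r0 rE] := cbrt_exists (mulf_neq0 X0 (invr_neq0 y10)).
  have ? : x3 = r ^+ 3 * y1 + 3 / 2 * x1 * x2 / y1 - x1 ^+ 3 / (2 * y1 ^+ 2).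
    by rewrite -rE XE; field; nz.
  clear d rE X0 XE; subst x3.
  normalise_by (r ^+ 2) r ((x1 ^+ 2 / (2 * y1) - x2) / y1) (- (x1 / (2 * y1)))
    (Dhalf_S7 (erefl (2^-1 : K))).
subst y1; have {}d : x1 * y2 * (c * x1) != 0.
  by move: d; congr (_ != 0); rewrite /det3; ring.
move: d; rewrite !mulf_eq0 !negb_or => /andP[/andP[p0 _] /andP[c0 _]].
have ? : y2 = x1 by lc (mulr_eq0r C2 c0).
clear C2; subst y2; have c0' := elimN eqP c0.
have [/eqP|c1] := eqVneq (1 + c) 0; last first.
  normalise_by (1 : K) (1 : K)
    (- ((x3 - (1 + c) * x2 ^+ 2 / (2 * x1)) / (x1 * (1 + c))))
    (- (x2 / (2 * x1))) (Dhalf_S5 (erefl (2^-1 : K)) c0').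
rewrite addrC addr_eq0 => /eqP ?; subst c; have [?|x30] := eqVneq x3 0.
  subst x3; normalise_by (1 : K) (1 : K) (0 : K) (- (x2 / (2 * x1)))
    (Dhalf_S5 (erefl (2^-1 : K)) c0').
have [r r0 rE] := sqrt_exists (mulf_neq0 x30 (invr_neq0 p0)).
have ? : x3 = r ^+ 2 * x1 by rewrite -rE; field; nz.
clear x30 rE; subst x3; normalise_by (r ^+ 2) r (0 : K) (- (x2 / (2 * x1)))
  (Dhalf_S6 (erefl (2^-1 : K))).
Qed.

(** [Dl_19] arises for [z2 = 0]; for [z2 != 0], [Dl_18] if [y1 != 0], [Dl_16] and
    [Dl_17] if [y1 = 0]. *)
Lemma normalise_BIV l b c (q : cochain K) :
  generic_weight l -> l <> -1 ->
  bijective_cocycle (Dl_bracket l) (repBIV b c) q ->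
  normalises l BIV (repBIV b c) q (repBIV b c).
Proof.
move=> gl lN1; have [l0 l1 l2 _] := gl.
have l1a : l - 1 != 0 by rewrite subr_eq0.
have l2a : l - 2 != 0 by rewrite subr_eq0.
rewrite {1}repBIV_ut; move: q; apply: cocycle_ind.
move=> x1 y1 z1 x2 y2 z2 x3 y3 z3 bq d A1 _ B1 B2 B3 C1 _ C3.
have ? : y2 = 0 by lc A1.
have ? : y3 = b * x1 by lc (esym B1).
subst y2 y3.
have {}B2 : (b - 1) * y1 = 0 by lc B2.
have {}B3 : (c - 1) * z1 = 0 by lc B3.
have {}C1 : (b + 1 - l) * x2 = 0 by lc C1.
have {}C3 : (c - l) * z2 = 0 by lc C3.
clear A1 B1; have [?|z20] := eqVneq z2 0.
  subst z2; have {}d : x2 * (z1 * (b * x1) - y1 * z3) != 0.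
    by move: d; congr (_ != 0); rewrite /det3; ring.
  move: d; rewrite mulf_eq0 negb_or => /andP[x20 d].
  have ? : b = l - 1 by lc (mulr_eq0l C1 x20).
  subst b; have ? : y1 = 0 by apply: mulr_eq0r l2a; lc B2.
  subst y1; move: d; rewrite mul0r subr0 !mulf_eq0 !negb_or.
  case/and3P=> z10 _ x10; have ? : c = 1 by lc (mulr_eq0l B3 z10).
  subst c; normalise_by (1 : K) ((l - 1) * x1 / x2) (- (z3 / z1))
    ((l * x1 * z3 / z1 - x3) / x2) (Dl_19 lN1).
have ? : c = l by lc (mulr_eq0l C3 z20).
subst c; have ? : z1 = 0 by apply: mulr_eq0r l1a.
subst z1; have [?|y10] := eqVneq y1 0; last first.
  have ? : b = 1 by lc (mulr_eq0l B2 y10).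
  subst b; have ? : x2 = 0 by apply: mulr_eq0r l2a; lcf (-1 : K) C1.
  subst x2; have [X XE] : exists X, X = x3 - x1 ^+ 2 / y1 by eexists.
  have X0 : X != 0.
    apply: contraNneq d => X0; apply/eqP.
    by apply: (eq_of_sub (congr1 ( *%R (y1 * z2)) X0)); rewrite XE /det3; field; nz.
  have [r r0 rE] := sqrt_exists (mulf_neq0 X0 (invr_neq0 y10)).
  have ? : x3 = r ^+ 2 * y1 + x1 ^+ 2 / y1 by rewrite -rE XE; field; nz.
  clear d rE X0 XE; subst x3.
  normalise_by r (1 : K) (- (x1 / y1)) (- (z3 / z2)) (Dl_18 lN1).
subst y1; have {}d : z2 * (b * x1 * x1) != 0.
  by apply: contraNneq d => E; apply/eqP; rewrite /det3; lcf (-1 : K) E.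
move: d; rewrite !mulf_eq0 !negb_or => /and3P[_ /andP[b0 x10] _].
have b0' := elimN eqP b0.
have [/eqP|b1] := eqVneq (1 + b) 0.
  rewrite addrC addr_eq0 => /eqP ?; subst b.
  have ? : x2 = 0 by apply: mulr_eq0r l0; lcf (-1 : K) C1.
  subst x2; have [?|x30] := eqVneq x3 0.
    subst x3; normalise_by (1 : K) (1 : K) (0 : K) (- (z3 / z2))
      (Dl_16 lN1 b0').
  normalise_by (x3 / x1) (1 : K) (0 : K) (- (z3 / z2)) (Dl_17 lN1).
have [?|x20] := eqVneq x2 0.
  subst x2; normalise_by (1 : K) (1 : K) (- (x3 / (x1 * (1 + b))))
    (- (z3 / z2)) (Dl_16 lN1 b0').
have ? : b = l - 1 by lc (mulr_eq0l C1 x20).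
subst b; normalise_by (1 : K) (1 : K) (- ((x3 - x2 * z3 / z2) / (x1 * l)))
  (- (z3 / z2)) (Dl_16 lN1 b0').
Qed.

(** The equations force [q e1] and [q e2] to be multiples of [v1]. *)
Lemma cocycle_BV l c (q : cochain K) :
  generic_weight l -> ~ bijective_cocycle (Dl_bracket l) (repBV c) q.
Proof.
case=> l0 l1 l2 _; have l1a : l - 1 != 0 by rewrite subr_eq0.
have l2a : l - 2 != 0 by rewrite subr_eq0.
rewrite repBV_ut; move: q; apply: cocycle_ind.
move=> x1 y1 z1 x2 y2 z2 x3 y3 z3 _ d A1 _ _ B2 B3 C1 _ C3.
have ? : y2 = 0 by lc A1.
have z2E : z2 = (l - c) * x2 by lc C1.
have {}C3 : (l - c) * z2 = 0 by lc (esym C3).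
have h2 : z2 = 0.
  by move/eqP: C3; rewrite mulf_eq0 => /orP[/eqP E|/eqP//]; rewrite z2E E mul0r.
rewrite h2 in z2E; subst y2 z2; have x20 : x2 != 0.
  by apply: contraNneq d => ->; apply/eqP; rewrite /det3; ring.
have ? : c = l by lc (esym (mulr_eq0l (esym z2E) x20)).
subst c; have ? : y1 = 0 by apply: mulr_eq0r l2a; lc B2.
have ? : z1 = 0 by apply: mulr_eq0r l1a; lc B3.
by subst y1 z1; case/eqP: d; rewrite /det3; ring.
Qed.

Lemma normalise_BVI l c (q : cochain K) :
  generic_weight l -> l <> -1 ->
  bijective_cocycle (Dl_bracket l) (repBVI c) q ->
  normalises l BVI (repBVI c) q (repBVI c).
Proof.
move=> gl lN1; have [l0 l1 l2 _] := gl.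
have l1b : 1 - l != 0 by rewrite subr_eq0 eq_sym.
have lp1 : 1 + l != 0 by rewrite addrC addr_eq0; apply/eqP.
rewrite {1}repBVI_ut; move: q; apply: cocycle_ind.
move=> x1 y1 z1 x2 y2 z2 x3 y3 z3 bq d _ A2 B1 B2 B3 C1 C2 _.
have ? : z2 = 0 by lc A2.
have z1E : z1 = (1 - c) * x1 by lc B1.
have {}B3 : (1 - c) * z1 = 0 by lc (esym B3).
have h1 : z1 = 0.
  by move/eqP: B3; rewrite mulf_eq0 => /orP[/eqP E|/eqP//]; rewrite z1E E mul0r.
rewrite h1 in z1E; have ? : z3 = c * y1 by lc (esym B2).
subst z1 z2 z3; have {}d : c * y1 * (x1 * y2 - x2 * y1) != 0.
  by move: d; congr (_ != 0); rewrite /det3; ring.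
move: d; rewrite !mulf_eq0 !negb_or => /andP[/andP[c0 y10] d].
have {}C1 : (c - l) * x2 = 0 by lc C1.
have {}C2 : (c + 1 - l) * y2 = 0 by lc C2.
have x20 : x2 != 0.
  apply: contraNneq d => E; rewrite E in C1 *.
  have [->|x10] := eqVneq x1 0; first by rewrite !mul0r subr0.
  have cE : c = 1 by lc (esym (mulr_eq0l (esym z1E) x10)).
  have -> : y2 = 0.
    apply: mulr_eq0r C2 _; rewrite cE subr_eq0 eq_sym; exact: l2.
  by rewrite mulr0 mul0r subr0.
have ? : c = l by lc (mulr_eq0l C1 x20).
subst c; have ? : y2 = 0 by lc C2.
have ? : x1 = 0 by apply: mulr_eq0r (esym z1E) _.
subst y2 x1; normalise_by (1 : K) (l * y1 / x2) (- (y3 / (y1 * (1 + l))))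
  (0 : K) (Dl_20 lN1).
Qed.

Lemma normalise_CI l c (q : cochain K) :
  generic_weight l -> l <> -1 ->
  bijective_cocycle (Dl_bracket l) (repCI c) q ->
  normalises l CI (repCI c) q (repCI c).
Proof.
move=> gl lN1; have [l0 l1 l2 l3] := gl.
have l3a : l - 3 != 0 by rewrite subr_eq0.
rewrite {1}repCI_ut; move: q; apply: cocycle_ind.
move=> x1 y1 z1 x2 y2 z2 x3 y3 z3 bq d A1 A2 B1 B2 B3 C1 _ _.
have ? : z2 = 0 by lc A2.
subst z2; have ? : y2 = 0 by lc A1.
subst y2; have ? : y3 = (c + 1) * x1 by lc (esym B1).
subst y3; have {}d : x2 * (z1 * ((c + 1) * x1) - y1 * z3) != 0.
  by move: d; congr (_ != 0); rewrite /det3; ring.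
move: d; rewrite mulf_eq0 negb_or => /andP[x20 d].
have {}C1 : (c + 2 - l) * x2 = 0 by lc C1.
have ? : c = l - 2 by lc (mulr_eq0l C1 x20).
subst c; have ? : z1 = 0 by apply: mulr_eq0r l3a; lc B3.
subst z1; move: d; rewrite mul0r sub0r oppr_eq0 mulf_eq0 negb_or.
case/andP=> y10 _; have ? : z3 = (l - 2) * y1 by lc (esym B2).
subst z3; normalise_by (1 : K) (y1 / x2) (- (x1 / y1))
  ((l * x1 ^+ 2 / (2 * y1) - x3) / x2) (Dl_21 lN1).
Qed.

(** * Distinct displayed cocycles are inequivalent *)

(* Discards an entry of another case. *)
Ltac drop_entry :=
  by move=> *; match goal with E : _ = _ :> rep_case |- _ => discriminate E end.

Lemma ut_inj (d1 d2 d3 a21 a31 a32 d1' d2' d3' a21' a31' a32' : K) :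
  ut d1 d2 d3 a21 a31 a32 = ut d1' d2' d3' a21' a31' a32' ->
  [/\ d1 = d1', d2 = d2' & d3 = d3'].
Proof.
case/linmap_inj=> /row3_inj[-> _ _] /row3_inj[_ -> _].
by case/row3_inj=> _ _ ->.
Qed.

Lemma rep_inj (A1 A2 B1 B2 : 'End('rV[K]_3))
    (d1 d2 d3 a21 a31 a32 d1' d2' d3' a21' a31' a32' : K) :
  linmap A1 A2 (ut d1 d2 d3 a21 a31 a32) =
    linmap B1 B2 (ut d1' d2' d3' a21' a31' a32') ->
  [/\ d1 = d1', d2 = d2' & d3 = d3'].
Proof. by case/linmap_inj=> _ _ /ut_inj. Qed.

(* The expression asserted nonzero by n is, up to the factor k, the difference of
   the two sides of h. *)
Ltac refute_with h k n :=
  by case/eqP: n; apply: (eq_of_sub (congr1 ( *%R k) h)); clear; field.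

Ltac refute_signed h n :=
  first [refute_with h (1 : K) n | refute_with h (-1 : K) n].

Ltac refute_scaled h k n :=
  first [refute_with h (k : K) n | refute_with h (- k : K) n].

(* Two entries whose representations have different diagonal parameters: one of
   [1], [l], [l - 1], [l - 2] is a multiple of the difference of two of them. *)
Ltac refute_parameters l0 l1a l2a h1 h2 h3 :=
  let o := constr:(oner_neq0 K) in
  solve [exfalso;
    first [refute_signed h3 l1a | refute_signed h3 o | refute_signed h3 l0
          | refute_scaled h3 (2^-1 : K) l1a | refute_scaled h2 (2^-1 : K) l0
          | refute_scaled h3 (2 : K) o | refute_signed h3 l2a
          | refute_signed h2 o | refute_scaled h2 (2^-1 : K) o
          | refute_scaled h3 (2 / 3 : K) o | refute_signed h1 l1a]].

(** The two shapes of an isomorphism between two products: a triangular one, and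
    for [l = -1] one that exchanges the first two basis vectors up to scalars. *)
Lemma dl_iso_ind l (m1 m2 : product K) (P : Prop) :
  generic_weight l ->
  (forall al be u w : K, al != 0 -> be != 0 ->
     al * al != 0 -> be * be != 0 -> al * be != 0 ->
     (forall a b c x y z, dl_aut al be u w (m2 (row3 a b c) (row3 x y z)) =
        m1 (row3 (a * al + c * u) (b * be + c * w) c)
           (row3 (x * al + z * u) (y * be + z * w) z)) -> P) ->
  (forall al be u w : K, l = -1 -> al != 0 -> be != 0 ->
     (forall a b c x y z,
        linmap (row3 0 al 0) (row3 be 0 0) (row3 u w (-1))
          (m2 (row3 a b c) (row3 x y z)) =
        m1 (row3 (b * be + c * u) (a * al + c * w) (- c))
           (row3 (y * be + z * u) (x * al + z * w) (- z))) -> P) ->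
  (exists2 T : 'End('rV[K]_3), lie_automorphism (Dl_bracket l) T &
     forall x y, T (m2 x y) = m1 (T x) (T y)) -> P.
Proof.
move=> [l0 l1 _ _] IH1 IH2 [T aT Tm].
case: (lie_automorphism_cases l0 l1 aT) Tm.
  case=> [al [be [u [w [al0 be0 ->]]]]] Tm.
  apply: (IH1 al be u w)=> //; rewrite ?mulf_neq0 // => a b c x y z.
  by rewrite Tm !linmap_row3_row3; congr (m1 (row3 _ _ _) (row3 _ _ _)); ring.
case=> [al [be [u [w [al0 be0 lm1 ->]]]]] Tm.
apply: (IH2 al be u w)=> // a b c x y z.
by rewrite Tm !linmap_row3_row3; congr (m1 (row3 _ _ _) (row3 _ _ _)); ring.
Qed.

(* The coordinates of the equation Tm at the vectors (a, b, c) and (x, y, z). *)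
Ltac at_basis Tm a b c x y z :=
  move: (Tm a b c x y z);
  rewrite !table_product_cons !table_product_nil !row3_coord !row3E;
  rewrite linmap_row3_row3 => /row3_inj[].

(* The isomorphism equation is contradictory on a pair (ei, ej) of basis vectors
   that depends on the case.  Only the comparison of [Dhalf_S5] with [Dhalf_S6]
   needs two coordinates: on (e3, e3) the second one gives [w = 0], and the first
   one then a contradiction. *)
Ltac refute_dl_aut Tm w al0 be0 al2 be2 ab :=
  let o := constr:(oner_neq0 K) in
  let X := fresh in let Y := fresh in let Z := fresh in
  let at11 :=
    (at_basis Tm (1 : K) (0 : K) (0 : K) (1 : K) (0 : K) (0 : K); move=> _ _ Z;
     first [refute_signed Z o | refute_signed Z al2]) in
  let at12 :=
    (at_basis Tm (1 : K) (0 : K) (0 : K) (0 : K) (1 : K) (0 : K); move=> _ _ Z;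
     first [refute_signed Z o | refute_signed Z ab]) in
  let at13 :=
    (at_basis Tm (1 : K) (0 : K) (0 : K) (0 : K) (0 : K) (1 : K); move=> _ Y _;
     first [refute_signed Y al0 | refute_signed Y be0]) in
  let at22 :=
    (at_basis Tm (0 : K) (1 : K) (0 : K) (0 : K) (1 : K) (0 : K); move=> X _ Z;
     first [ refute_signed Z o | refute_signed Z be2
           | refute_signed X al0 | refute_signed X be2 ]) in
  let at23 :=
    (at_basis Tm (0 : K) (1 : K) (0 : K) (0 : K) (0 : K) (1 : K); move=> X _ _;
     first [refute_signed X al0 | refute_signed X be0]) in
  let at33 :=
    (at_basis Tm (0 : K) (0 : K) (1 : K) (0 : K) (0 : K) (1 : K); move=> X Y _;
     first [ refute_signed X al0 | refute_signed X o
           | refute_signed Y be0 | refute_signed Y o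
           | (have ? : w = 0 by lcf (2 : K) Y); subst w;
             first [refute_signed X al0 | refute_signed X o] ]) in
  match goal with
  | _ : AIV = _ |- _ => first [at22 | at33]
  | _ : AVI = _ |- _ => at33
  | _ : AVII = _ |- _ => at22
  | _ : BII = _ |- _ => first [at23 | at33 | at13]
  | _ : BIII = _ |- _ => first [at12 | at33]
  | _ : BIV = _ |- _ => first [at11 | at33]
  end.

(* A map exchanging the lines of e1 and e2 sends e3 to -e3 up to e1 and e2, so
   that the coefficient of e3 in e3 * e3 would equal its opposite; when e3 also
   occurs in e2 * e2, one of the other two pairs is used. *)
Ltac refute_swap Tm be0 :=
  let o := constr:(oner_neq0 K) in
  let X := fresh in let Z := fresh in
  first
  [ at_basis Tm (0 : K) (0 : K) (1 : K) (0 : K) (0 : K) (1 : K); move=> _ _ Z;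
    first [refute_scaled Z (2^-1 : K) o | refute_scaled Z (4^-1 : K) o]
  | at_basis Tm (0 : K) (1 : K) (0 : K) (0 : K) (0 : K) (1 : K); move=> X _ _;
    refute_signed X be0
  | at_basis Tm (0 : K) (1 : K) (0 : K) (0 : K) (1 : K) (0 : K); move=> _ _ Z;
    refute_signed Z o ].

(** Displayed cocycles of one representation with isomorphic products are equal.
    The indices are duplicated so that both entries can be made explicit. *)
Lemma listed_iso_inj l f1 q1 m1 f2 q2 m2 cs1 cs2 :
  generic_weight l ->
  listed l cs1 f1 q1 m1 -> listed l cs2 f2 q2 m2 -> cs1 = cs2 -> f1 = f2 ->
  (exists2 T : 'End('rV[K]_3), lie_automorphism (Dl_bracket l) T &
     forall x y, T (m2 x y) = m1 (T x) (T y)) -> q1 = q2.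
Proof.
move=> gl H1 H2 E fE iso; have [l0 l1 l2 _] := gl.
have l1a : l - 1 != 0 by rewrite subr_eq0.
have l2a : l - 2 != 0 by rewrite subr_eq0.
case: H1 E fE iso => *; match goal with H : listed _ ?cs ?f _ ?m, E : _ = ?cs,
    B : _ = ?f, A : ex2 _ _ |- _ =>
  move: A B E; case: H; try drop_entry end.
all: move=> *; match goal with H : @eq (rep _) _ _ |- _ =>
  move: H; rewrite !rep_ut => /rep_inj[h1 h2 h3] end.
(* Before an equation [l = 1] is used for substitution. *)
all: try solve [exfalso; first [refute_with h3 (1 : K) l1a
                              | refute_with h3 (-1 : K) l1a]].
all: subst => //.
all: try refute_parameters l0 l1a l2a h1 h2 h3.
all: exfalso; match goal with I : ex2 _ _ |- _ => move: I end.
all: apply: dl_iso_ind gl _ _ => al be u w.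
all: try (move=> al0 be0 al2 be2 ab Tm; refute_dl_aut Tm w al0 be0 al2 be2 ab).
(* The exchange requires [l = -1], which excludes the entries with [l <> -1],
   [l = 2^-1] and [l = 3^-1]. *)
all: try (move=> lm1 al0 be0 Tm; try contradiction;
   try solve [refute_with lm1 (2 / 3 : K) (oner_neq0 K)
      | refute_with lm1 (3 / 4 : K) (oner_neq0 K)];
   (subst; refute_swap Tm be0)).
Qed.

(** * The classification *)

Lemma listed_AI l cs (f : rep K) q m :
  listed l cs f q m -> cs = AI -> exists lam, f = repAI 1 l lam.
Proof. by case; try drop_entry; move=> lam _; exists lam. Qed.

(** Only in case AI may the target differ from [f], by a permutation of the
    diagonal entries; it does not if [f] is already displayed. *)
Lemma normalise_in_case l cs (f : rep K) (q : cochain K) :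
  generic_weight l -> in_case l cs f -> bijective_cocycle (Dl_bracket l) f q ->
  exists2 f0, normalises l cs f q f0 & listed_rep l cs f -> f0 = f.
Proof.
move=> gl; have [_ l1 _ _] := gl.
case: cs => /= [[a [b [c ->]]]|[a [c ->]]|[a ->]|[b [c ->]]|[c ->]|[c ->]|[c ->]
  |[c ->]|[c ->]|[lE [c ->]]|[lN [b [c ->]]]|[lN [c ->]]|[lN [c ->]]|[lN [c ->]]] qc.
- exists (repAI 1 l (a + b + c - 1 - l)); first exact: normalise_AI.
  move=> [q0 [m0 H]]; have [lam fE] := listed_AI H (erefl _).
  have [-> -> _] : [/\ a = 1, b = l & c = lam].
    by move: fE; rewrite !repAI_ut => /rep_inj.
  by congr repAI; ring.
- by exists (repAII a c) => //; apply: normalise_AII.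
- by case: (cocycle_AIII l1 qc).
- by exists (repAIV l b c) => //; apply: normalise_AIV.
- by exists (repAV l c) => //; apply: normalise_AV.
- by exists (repAVI l c) => //; apply: normalise_AVI.
- by exists (repAVII l c) => //; apply: normalise_AVII.
- by exists (repBI l c) => //; apply: normalise_BI.
- by exists (repBII l c) => //; apply: normalise_BII.
- by exists (repBIII c) => //; rewrite lE in qc *; apply: normalise_BIII.
- by exists (repBIV b c) => //; apply: normalise_BIV.
- by case: (cocycle_BV gl qc).
- by exists (repBVI c) => //; apply: normalise_BVI.
by exists (repCI c) => //; apply: normalise_CI.
Qed.

End Classification.

Lemma norm_unit_circle (R : realType) (t : R) :
  `|Complex (cos t) (sin t)| = 1 :> complex R.
Proof. by rewrite normc_def /= cos2Dsin2 sqrtr1. Qed.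

Lemma norm_le1_neq_nat (K : numClosedFieldType) (n : nat) (l : K) :
  `|l| <= 1 -> (1 < n)%N -> l != n%:R.
Proof.
by move=> l1 n1; apply: contraTneq l1 => ->; rewrite normr_nat lern1 -ltnNge.
Qed.

Lemma weight_generic (R : realType) (l : complex R) :
 (0 < `|l| /\ `|l| < 1) \/
          (exists theta : R,
             [/\ 0 < theta, theta <= pi & l = Complex (cos theta) (sin theta)]) ->
  [/\ l != 0, l != 1, l != 2 & l != 3].
Proof.
move=> hl; have [l0 l1 le1] : [/\ l != 0, l != 1 & `|l| <= 1].
  case: hl => [[p0 p1]|[t [t0 tpi lE]]].
    split; [by rewrite -normr_gt0| |exact: ltW].
    by apply: contraTneq p1 => ->; rewrite normr1 ltxx.
  have n1 : `|l| = 1 by rewrite lE norm_unit_circle.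
  split; [by rewrite -normr_gt0 n1| |by rewrite n1].
  apply/eqP; rewrite lE => -[cos1 _].
  suff t00 : t = 0 by rewrite t00 ltxx in t0.
  apply: cos_inj; rewrite ?cos0 // in_itv /= ?lexx ?pi_ge0 //.
  by rewrite tpi ltW.
split=> //.
exact (@norm_le1_neq_nat _ 2 l le1 isT).
exact (@norm_le1_neq_nat _ 3 l le1 isT).
Qed.

Theorem proposition3p13 (R : realType) (l : complex R)
    (hl : (0 < `|l| /\ `|l| < 1) \/
          (exists theta : R,
             [/\ 0 < theta, theta <= pi & l = Complex (cos theta) (sin theta)]))
    (cs : rep_case) :
  (forall f : rep (complex R), in_case l cs f ->
     ((exists q : cochain (complex R), bijective_cocycle (Dl_bracket l) f q) <->
      (exists f' : rep (complex R),
         listed_rep l cs f' /\ rep_equivalent (Dl_bracket l) f f')))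
  /\
  (forall f : rep (complex R), listed_rep l cs f ->
     [/\ forall (q : cochain (complex R)) (m : product (complex R)),
           listed l cs f q m ->
           [/\ bijective_cocycle (Dl_bracket l) f q,
               left_symmetric m
             & alg_isomorphic (cocycle_product f q) m],
         forall q : cochain (complex R), bijective_cocycle (Dl_bracket l) f q ->
           exists q0 : cochain (complex R), listed_cocycle l cs f q0 /\
             cocycle_equivalent (Dl_bracket l) f q f q0
       & forall q1 q2 : cochain (complex R),
           listed_cocycle l cs f q1 -> listed_cocycle l cs f q2 ->
           cocycle_equivalent (Dl_bracket l) f q1 f q2 -> q1 = q2]).
Proof.
have gl : generic_weight l := weight_generic hl.
split=> f.
  move=> fcs; split=> [[q qc]|[f' [lf' ff']]].
    have [f0 [q0 [m0 [lq0 qq0]]] _] := normalise_in_case gl fcs qc.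
    exists f0; split; first by exists q0, m0.
    exact: rep_equivalent_of_cocycle qq0.
  have [q' [m' lq']] := lf'.
  exact: rep_equivalent_bijective_cocycle ff' (listed_bijective_cocycle gl lq').
move=> lf; have [q0 [m0 lq0]] := lf; have fcs := listed_in_case lq0.
split=> [q m lq|q qc|q1 q2].
- have qm := listed_realises gl lq; have qc := listed_bijective_cocycle gl lq.
  split=> //; first exact: realises_left_symmetric qc qm (listed_bilinear lq).
  exact: realises_alg_isomorphic qm.
- have [f0 + f0E] := normalise_in_case gl fcs qc; rewrite (f0E lf).
  by case=> [q1 [m1 [lq1 qq1]]]; exists q1; split=> //; exists m1.
move=> [m1 lq1] [m2 lq2] q12; apply: (listed_iso_inj gl lq1 lq2)=> //.
exact: iso_of_cocycle_equivalent (listed_realises gl lq1)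
  (listed_realises gl lq2) q12.
Qed.
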